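(* Let $\mathbb{F}$ be a finite field, $H\ge 1$ an integer, and let $\mathcal{B}=\mathbb{F}[x]/(x^H)$. Let $T\in\mathcal{B}^{n_0\times\dots\times n_{D-1}}$ be a concise tensor and $R\ge 0$ an integer. There is an algorithm that either returns a rank-$R$ CPD of $T$ over $\mathcal{B}$ or correctly determines that none exists, running in time \[O^*\left(|\mathbb{F}|^{H\sum_{1\le r\le R}\sum_{d} \min(r,n_d)}\right)\] and using $O^*(1)$ space.
   Context: For a commutative ring $\mathcal{B}$, a rank-$R$ CPD of $T\in\mathcal{B}^{n_0\times\dots\times n_{D-1}}$ is a list of matrices $A_d\in\mathcal{B}^{n_d\times R}$ with $T_{i_0,\dots,i_{D-1}}=\sum_{0\le r<R}\prod_{d}(A_d)_{i_d,r}$ for all indices; the rank of $T$ is the least such $R$ (for a matrix, this is the least $r$ with $M=UV$, $U$ having $r$ columns). $T$ is concise if for every axis $d$ the unfolding matrix $T_{(d)}$ (whose $i_d$-th row is the vectorization of the slice with $d$-th index $i_d$) has rank $n_d$ over $\mathcal{B}$. $O^*(\cdot)$ suppresses factors polynomial in the input size. *)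

(* Defs.v *)
From mathcomp Require Import all_boot all_order all_algebra.
From mathcomp Require Import qpoly.

Set Implicit Arguments.
Unset Strict Implicit.
Unset Printing Implicit Defensive.

Import GRing.Theory.

Section Tensors.

Variables (B : comNzRingType) (D : nat) (n : 'I_D -> nat).

Definition midx := {dffun forall d : 'I_D, 'I_(n d)}.

Definition tensor := midx -> B.

Definition is_cpd (T : tensor) (R : nat) (A : forall d : 'I_D, 'M[B]_(n d, R)) :
  Prop :=
  forall i : midx, T i = (\sum_(r < R) \prod_(d < D) A d (i d) r)%R.

(* Multi-indices over all axes except d: the columns of the d-th unfolding. *)
Definition midx' (d : 'I_D) :=
  {dffun forall e : {e : 'I_D | e != d}, 'I_(n (val e))}.

Definition insert_idx (d : 'I_D) (i : 'I_(n d)) (j : midx' d) : midx :=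
  finfun (fun e : 'I_D =>
    match eqVneq e d with
    | EqNotNeq ed => cast_ord (congr1 n (esym ed)) i
    | NeqNotEq ned => j (exist _ e ned)
    end).

Definition unfolding (T : tensor) (d : 'I_D) : 'M[B]_(n d, #|{: midx' d}|) :=
  (\matrix_(i, j) T (insert_idx i (enum_val j)))%R.

(* MathComp's \rank is only defined over a field, hence this notion of rank. *)
Definition factors_through (p q : nat) (M : 'M[B]_(p, q)) (r : nat) : Prop :=
  exists (U : 'M[B]_(p, r)) (V : 'M[B]_(r, q)), M = (U *m V)%R.

Definition has_rank (p q : nat) (M : 'M[B]_(p, q)) (r : nat) : Prop :=
  factors_through M r /\ forall s, factors_through M s -> r <= s.

Definition concise (T : tensor) : Prop :=
  forall d : 'I_D, has_rank (unfolding T d) (n d).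

(* Row-major (lexicographic) enumeration of the multi-indices. *)
Definition midx_pos (i : midx) : nat :=
  \sum_(d < D) i d * \prod_(e < D | d < e) n e.

Definition midx_list : seq midx :=
  sort (fun i j => midx_pos i <= midx_pos j) (enum {: midx}).

End Tensors.

(* Model of computation: while-programs over natural numbers, with a
   random-access read-only input, a random-access working memory whose cells
   initially hold 0, and a write-only output.  Elements of the finite field F
   are handled through their index in (enum F), a number below #|F|, and the
   arithmetic of F is primitive.  Programs are pure syntax that does not
   mention F, so that one and the same program can be run over every finite
   field.

   Time is the number of executed commands and tests; the list of remaining
   commands is bounded in terms of the program.  Space is the number of
   bits of the working memory, counted up to the highest address ever written.
   An expression of a fixed program involves boundedly many operations, so the
   numbers it produces have length linear in that of the memory and input cells
   and of its constants: a step costs a number of bit operations polynomial in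
   the space, the input size and log #|F|.  Up to the polynomial factors hidden
   in O*, polynomial-space computations have therefore the same cost here and
   on a Turing machine. *)

Variant natop := NAdd | NSub | NMul | NDiv | NMod | NEq | NLt.

Variant fldop := FAdd | FSub | FMul | FDiv.

Inductive expr :=
| Const of nat
| Input of expr
| Fetch of expr
| NatOp of natop & expr & expr
| FZero
| FOne
| FldOp of fldop & expr & expr.

Inductive cmd :=
| Skip
| Store of expr & expr
| Emit of expr
| Seq of cmd & cmd
| If of expr & cmd & cmd
| While of expr & cmd.

Definition code (F : finFieldType) (a : F) : nat := index a (enum F).

Definition decode (F : finFieldType) (m : nat) : F := nth 0%R (enum F) m.

Definition eval_natop (o : natop) (a b : nat) : nat :=
  match o with
  | NAdd => a + b
  | NSub => a - b
  | NMul => a * b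
  | NDiv => a %/ b
  | NMod => a %% b
  | NEq => a == b
  | NLt => a < b
  end.

Definition eval_fldop (F : finFieldType) (o : fldop) (a b : F) : F :=
  match o with
  | FAdd => a + b
  | FSub => a - b
  | FMul => a * b
  | FDiv => a / b
  end%R.

Fixpoint eval (F : finFieldType) (inp mem : seq nat) (e : expr) : nat :=
  match e with
  | Const m => m
  | Input e1 => nth 0 inp (eval F inp mem e1)
  | Fetch e1 => nth 0 mem (eval F inp mem e1)
  | NatOp o e1 e2 => eval_natop o (eval F inp mem e1) (eval F inp mem e2)
  | FZero => code (0%R : F)
  | FOne => code (1%R : F)
  | FldOp o e1 e2 =>
      code (eval_fldop o (decode F (eval F inp mem e1))
                         (decode F (eval F inp mem e2)))
  end.

Record config := Config {
  todo : seq cmd;      (* remaining commands; empty when the run has halted *)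
  memory : seq nat;
  output : seq nat
}.

Definition init (P : cmd) : config := Config [:: P] [::] [::].

Definition step (F : finFieldType) (inp : seq nat) (s : config) : config :=
  let: Config k mem out := s in
  let ev := eval F inp mem in
  match k with
  | [::] => s
  | c :: k' =>
      match c with
      | Skip => Config k' mem out
      | Store a e => Config k' (set_nth 0 mem (ev a) (ev e)) out
      | Emit e => Config k' mem (rcons out (ev e))
      | Seq c1 c2 => Config [:: c1, c2 & k'] mem out
      | If e c1 c2 => Config ((if ev e != 0 then c1 else c2) :: k') mem out
      | While e c1 => Config (if ev e != 0 then [:: c1, c & k'] else k') mem out
      end
  end.

Definition run (F : finFieldType) (inp : seq nat) (P : cmd) (t : nat) : config :=
  iter t (step F inp) (init P).

Definition bits (s : seq nat) : nat := \sum_(m <- s) (trunc_log 2 m).+1.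

Definition runs_within (F : finFieldType) (P : cmd) (inp out : seq nat)
    (time space : nat) : Prop :=
  exists t : nat,
    [/\ t <= time,
        todo (run F inp P t) = [::],
        output (run F inp P t) = out
      & forall u, u <= t -> bits (memory (run F inp P u)) <= space].

(* For 0 < H this is F[x]/(x^H); for H = 0 the library type would degenerate
   to F[x]/(x). *)
Notation truncpoly F H := {poly %/ ('X^H : {poly F})%R}.

Section Encoding.

Variables (F : finFieldType) (H D : nat) (n : 'I_D -> nat).

Definition encode_elt (b : truncpoly F H) : seq nat :=
  [seq code ((val b)`_h)%R | h <- iota 0 H].

Definition encode_input (T : tensor (truncpoly F H) n) (R : nat) : seq nat :=
  [:: #|F|; H; R; D] ++ [seq n d | d <- enum 'I_D]
    ++ flatten [seq encode_elt (T i) | i <- midx_list n].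

Definition encode_cpd (R : nat)
    (A : forall d : 'I_D, 'M[truncpoly F H]_(n d, R)) : seq nat :=
  flatten [seq flatten [seq flatten [seq encode_elt (A d i r)
                                    | r <- enum 'I_R]
                       | i <- enum 'I_(n d)]
          | d <- enum 'I_D].

Definition correct_answer (T : tensor (truncpoly F H) n) (R : nat)
    (out : seq nat) : Prop :=
  (exists A : forall d : 'I_D, 'M[truncpoly F H]_(n d, R),
      is_cpd T A /\ out = 1 :: encode_cpd A)
  \/ (~ (exists A : forall d : 'I_D, 'M[truncpoly F H]_(n d, R), is_cpd T A)
      /\ out = [:: 0]).

End Encoding.

(* Main.v *)
(** A tensor has rank at most r iff some rank-one term can be subtracted from it
    leaving rank at most r - 1.  To guess the term cheaply, eliminate the d-th
    unfolding over the chain ring F[x]/(x^H), always pivoting on an entry of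
    minimal valuation.  Each pivot lowers the size of a factorization of the
    unfolding by one, so there are at most min(r, n_d) pivots; and projecting
    the d-th factor of a CPD along the elimination gives a CPD of the same
    tensor, so the d-th vector of the term may be sought in a module spanned by
    one vector per pivot.  Hence H * sum_d min(r, n_d) field elements describe
    the candidates at level r.

    The guesses of all levels are the digits in base |F| of one counter, so the
    search is a loop of polynomial-time trials in polynomial space.  R is first
    capped by the number N of entries, as every tensor with at least one axis
    has a CPD of rank N.  Conciseness is needed only when N = 0, where it makes
    all n_d vanish. *)
Require Import Defs.
From mathcomp Require Import all_boot all_order all_algebra.
From mathcomp Require Import qpoly zify ring.
From Stdlib Require Import FunctionalExtensionality.

Set Implicit Arguments.
Unset Strict Implicit.
Unset Printing Implicit Defensive.

Import GRing.Theory.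

(** * A structured language above the while-programs *)

(** Two facts replace field arithmetic: divisibility in F[x]/(x^H) is total, so an entry of least
    valuation divides the whole matrix, and a nonzero common factor can be cancelled from a
    divisibility although zero divisors exist.

    The pivots depend on the current tensor, hence on the guesses already made, and the bound min(r,
    n_d) on their number is only guaranteed when the current tensor has a CPD with r terms. So no
    digits are reserved for a level or an axis: each pivot takes the next H digits of the counter. A
    wrong guess may meet more pivots than expected and then reads digits 0 beyond the end. This is
    harmless, because success is decided only by the vanishing of the final residual.

    R is given in binary, so a memory holding R columns would not be polynomial; hence the cap. Only
    the printing of the answer still iterates R times. This fits in the time bound, since R is at
    most the sum over r and d of min(r, n_d) as soon as there is an axis and no n_d is zero. *)

Inductive ex :=
| EC of nat
| EI of ex
| EA of nat & ex
| EN of natop & ex & ex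
| E0
| E1
| EF of fldop & ex & ex.

Inductive stmt :=
| SSkip
| SSet of nat & ex & ex
| SEmit of ex
| SSeq of stmt & stmt
| SIf of ex & stmt & stmt
| SFor of bool & nat & ex & stmt
| SHalf of nat & ex & stmt.

(** Any number above the identifiers in use would do; the last identifier, 39, stands for the
    output. *)
Definition n_arrays := 40.

(* Interleaving the arrays k < n_arrays in the memory makes the disjointness of
   two arrays a comparison of constants. *)
Definition addr (k : nat) (e : expr) :=
  NatOp NAdd (NatOp NMul (Const n_arrays) e) (Const k).

Fixpoint compile_ex (e : ex) : expr :=
  match e with
  | EC m => Const m
  | EI e => Input (compile_ex e)
  | EA k e => Fetch (addr k (compile_ex e))
  | EN o e1 e2 => NatOp o (compile_ex e1) (compile_ex e2)
  | E0 => FZero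
  | E1 => FOne
  | EF o e1 e2 => FldOp o (compile_ex e1) (compile_ex e2)
  end.

Definition assign k i e := Store (addr k i) e.

(* A loop over array k keeps its counter in cell 0 of k and, for SFor, its bound
   in cell 1.  The counter of SHalf is halved at each iteration.  The boolean of
   SFor marks the loops that may run GB rather than M times. *)
Fixpoint compile (s : stmt) : cmd :=
  match s with
  | SSkip => Skip
  | SSet k i e => assign k (compile_ex i) (compile_ex e)
  | SEmit e => Emit (compile_ex e)
  | SSeq s1 s2 => Seq (compile s1) (compile s2)
  | SIf e s1 s2 => If (compile_ex e) (compile s1) (compile s2)
  | SFor _ k e s =>
      let i := Fetch (addr k (Const 0)) in
      Seq (assign k (Const 1) (compile_ex e))
          (Seq (assign k (Const 0) (Const 0))
               (While (NatOp NLt i (Fetch (addr k (Const 1))))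
                      (Seq (compile s) (assign k (Const 0) (NatOp NAdd i (Const 1))))))
  | SHalf k e s =>
      let i := Fetch (addr k (Const 0)) in
      Seq (assign k (Const 0) (compile_ex e))
          (While i (Seq (compile s) (assign k (Const 0) (NatOp NDiv i (Const 2)))))
  end.

(* Identifier of the output among the arrays that a statement may modify. *)
Definition out_array := 39.

Fixpoint mods (s : stmt) : seq nat :=
  match s with
  | SSkip => [::]
  | SSet k _ _ => [:: k]
  | SEmit _ => [:: out_array]
  | SSeq s1 s2 | SIf _ s1 s2 => mods s1 ++ mods s2
  | SFor _ k _ s | SHalf k _ s => k :: mods s
  end.

Fixpoint wf_ex (e : ex) : bool :=
  match e with
  | EC _ | E0 | E1 => true
  | EI e => wf_ex e
  | EA k e => (k < n_arrays) && wf_ex e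
  | EN _ e1 e2 | EF _ e1 e2 => wf_ex e1 && wf_ex e2
  end.

(** A loop body may not modify the array holding its own counter, so that the number of iterations
    is known on entry. *)
Fixpoint wf (s : stmt) : bool :=
  match s with
  | SSkip => true
  | SSet k i e => [&& k < out_array, wf_ex i & wf_ex e]
  | SEmit e => wf_ex e
  | SSeq s1 s2 => wf s1 && wf s2
  | SIf e s1 s2 => [&& wf_ex e, wf s1 & wf s2]
  | SFor _ k e s | SHalf k e s => [&& k < out_array, k \notin mods s, wf_ex e & wf s]
  end.

(** In [SFor], 5 counts two sequencings, two initialisations and the last test; in [SHalf], 3 counts
    one of each. The inner 3 counts the test, the sequencing and the counter update of an
    iteration. *)
Fixpoint time_bound (M GB : nat) (s : stmt) : nat :=
  match s with
  | SSkip | SSet _ _ _ | SEmit _ => 1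
  | SSeq s1 s2 | SIf _ s1 s2 => 1 + time_bound M GB s1 + time_bound M GB s2
  | SFor c _ _ s => 5 + (if c then GB else M) * (time_bound M GB s + 3)
  | SHalf _ _ s => 3 + M * (time_bound M GB s + 3)
  end.

(* Nesting depth of the loops whose number of iterations is only bounded by
   GB. *)
Fixpoint gdepth (s : stmt) : nat :=
  match s with
  | SSkip | SSet _ _ _ | SEmit _ => 0
  | SSeq s1 s2 | SIf _ s1 s2 => maxn (gdepth s1) (gdepth s2)
  | SFor c _ _ s => c + gdepth s
  | SHalf _ _ s => gdepth s
  end.

(** C and e come from the syntax alone, before M and GB are known; this is what makes the final
    constant uniform in the field and the tensor. *)
Lemma time_bound_poly (s : stmt) :
  exists C e, forall M GB, 0 < M -> 0 < GB ->
    time_bound M GB s <= C * M ^ e * GB ^ gdepth s.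
Proof.
have one : exists C e, forall M GB, 0 < M -> 0 < GB -> 1 <= C * M ^ e * GB ^ 0.
  by exists 1, 0.
have two C1 e1 g1 C2 e2 g2 t1 t2 :
    (forall M GB : nat, 0 < M -> 0 < GB -> t1 M GB <= C1 * M ^ e1 * GB ^ g1) ->
    (forall M GB : nat, 0 < M -> 0 < GB -> t2 M GB <= C2 * M ^ e2 * GB ^ g2) ->
    exists C e, forall M GB, 0 < M -> 0 < GB ->
      1 + t1 M GB + t2 M GB <= C * M ^ e * GB ^ maxn g1 g2.
  move=> h1 h2; exists (1 + C1 + C2), (e1 + e2) => M GB M0 G0.
  rewrite -mulnA !mulnDl mul1n; apply: leq_add; first apply: leq_add.
  - by rewrite muln_gt0 !expn_gt0 M0 G0.
  - apply: leq_trans (h1 _ _ M0 G0) _; rewrite -mulnA leq_mul2l leq_mul ?orbT //.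
      by rewrite leq_pexp2l ?leq_addr.
    by rewrite leq_pexp2l ?leq_maxl.
  apply: leq_trans (h2 _ _ M0 G0) _; rewrite -mulnA leq_mul2l leq_mul ?orbT //.
    by rewrite leq_pexp2l ?leq_addl.
  by rewrite leq_pexp2l ?leq_maxr.
have loop a C e g (c : bool) t :
    (forall M GB : nat, 0 < M -> 0 < GB -> t M GB <= C * M ^ e * GB ^ g) ->
    exists C e, forall M GB, 0 < M -> 0 < GB ->
      a + (if c then GB else M) * (t M GB + 3) <= C * M ^ e * GB ^ (c + g).
  move=> h; exists (a + C + 3), e.+1 => M GB M0 G0.
  have E0 : 0 < M ^ e by rewrite expn_gt0 M0.
  have Eg0 : 0 < GB ^ g by rewrite expn_gt0 G0.
  apply: (@leq_trans (a + (if c then GB else M) * ((C + 3) * M ^ e * GB ^ g))).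
    rewrite leq_add2l leq_mul2l; apply/orP; right.
    rewrite mulnDl mulnDl leq_add ?h // -mulnA leq_pmulr // muln_gt0 E0 //.
  apply: (@leq_trans (a + (C + 3) * M ^ e.+1 * GB ^ (c + g))).
    rewrite leq_add2l; case: c => /=.
      have -> : (C + 3) * M ^ e.+1 * GB ^ (1 + g) = GB * ((C + 3) * M ^ e * GB ^ g) * M.
        by rewrite add1n !expnS; lia.
      exact: leq_pmulr.
    by rewrite add0n expnS; lia.
  rewrite -(mulnA _ (M ^ e.+1)) -(mulnA (a + C + 3)) -[a + C + 3]addnA (mulnDl a).
  rewrite leq_add2r leq_pmulr //.
  by rewrite muln_gt0 !expn_gt0 M0 G0.
elim: s => [|k i e|e|s1 [C1 [e1 h1]] s2 [C2 [e2 h2]]|x s1 [C1 [e1 h1]] s2 [C2 [e2 h2]]|c k x s [C [e h]]|k x s [C [e h]]] //=.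
- exact: two h1 h2.
- exact: two h1 h2.
- exact: (loop 5 _ _ _ _ _ h).
- exact: (loop 3 _ _ _ false _ h).
Qed.

(** * Semantics of structured programs *)

Record state := State { ar :> nat -> nat -> nat; ou : seq nat }.

Definition upd (st : state) (k i v : nat) : state :=
  State (fun k' => if k' == k then fun i' => if i' == i then v else st k i'
                   else st k') (ou st).

Definition emit (st : state) (v : nat) : state := State st (rcons (ou st) v).

(** The number of halvings that bring n to 0, that is, of iterations of [SHalf]. *)
Definition nbits (n : nat) := if n == 0 then 0 else (trunc_log 2 n).+1.

Section Sem.

(* A bounds the indices of the arrays, V the values stored; M and GB bound the
   iterations of the two kinds of loops. *)
Variables (F : finFieldType) (inp : seq nat) (A V M GB : nat).

Fixpoint eval_ex (st : state) (e : ex) : nat :=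
  match e with
  | EC m => m
  | EI e => nth 0 inp (eval_ex st e)
  | EA k e => st k (eval_ex st e)
  | EN o e1 e2 => eval_natop o (eval_ex st e1) (eval_ex st e2)
  | E0 => code (0%R : F)
  | E1 => code (1%R : F)
  | EF o e1 e2 => code (eval_fldop o (decode F (eval_ex st e1)) (decode F (eval_ex st e2)))
  end.

(** The counter of [SFor] is set to [j.+1] instead of being incremented, so that a loop means a
    plain [iteri]; under [wf] the compiled increment has the same effect. *)
Fixpoint denote (s : stmt) (st : state) : state :=
  match s with
  | SSkip => st
  | SSet k i e => upd st k (eval_ex st i) (eval_ex st e)
  | SEmit e => emit st (eval_ex st e)
  | SSeq s1 s2 => denote s2 (denote s1 st)
  | SIf e s1 s2 => if eval_ex st e != 0 then denote s1 st else denote s2 st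
  | SFor _ k e s =>
      iteri (eval_ex st e) (fun j st => upd (denote s st) k 0 j.+1)
            (upd (upd st k 1 (eval_ex st e)) k 0 0)
  | SHalf k e s =>
      iter (nbits (eval_ex st e))
           (fun st => let st' := denote s st in upd st' k 0 (st' k 0 %/ 2))
           (upd st k 0 (eval_ex st e))
  end.

Fixpoint safe (s : stmt) (st : state) : Prop :=
  match s with
  | SSkip | SEmit _ => True
  | SSet k i e => eval_ex st i < A /\ eval_ex st e < V
  | SSeq s1 s2 => safe s1 st /\ safe s2 (denote s1 st)
  | SIf e s1 s2 => if eval_ex st e != 0 then safe s1 st else safe s2 st
  | SFor c k e s =>
      [/\ eval_ex st e < V, eval_ex st e <= (if c then GB else M)
        & forall j, j < eval_ex st e ->
            safe s (iteri j (fun j st => upd (denote s st) k 0 j.+1)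
                      (upd (upd st k 1 (eval_ex st e)) k 0 0))]
  | SHalf k e s =>
      [/\ eval_ex st e < V, nbits (eval_ex st e) <= M
        & forall j, j < nbits (eval_ex st e) ->
            safe s (iter j (fun st => let st' := denote s st in
                                      upd st' k 0 (st' k 0 %/ 2))
                      (upd st k 0 (eval_ex st e)))]
  end.

Definition agree (ks : seq nat) (st st' : state) : Prop :=
  (forall k, k \notin ks -> st' k = st k)
  /\ (out_array \notin ks -> ou st' = ou st).

Lemma agree_trans ks st1 st2 st3 :
  agree ks st1 st2 -> agree ks st2 st3 -> agree ks st1 st3.
Proof.
by move=> [h1 o1] [h2 o2]; split=> [k hk|hk]; rewrite ?h2 ?h1 // o2 ?o1.
Qed.

Lemma agree_sub ks ks' st st' :
  {subset ks <= ks'} -> agree ks st st' -> agree ks' st st'.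
Proof.
move=> s [h o]; split=> [k hk|hk]; [apply: h|apply: o];
  by apply: contra hk; apply: s.
Qed.

Lemma agree_upd ks st k i v : k \in ks -> agree ks st (upd st k i v).
Proof.
by move=> kk; split=> //= k' hk'; case: eqP => // e; rewrite e kk in hk'.
Qed.

Lemma agree_iteri ks n f st :
  (forall j st, agree ks st (f j st)) -> agree ks st (iteri n f st).
Proof. by move=> h; elim: n => //= n IH; apply: agree_trans IH _. Qed.

(** The frame rule: that an array survives a statement becomes a membership test decided by
    computation. *)
Lemma denote_agree s : wf s -> forall st, agree (mods s) st (denote s st).
Proof.
have sub1 k (l : seq nat) : {subset l <= k :: l}.
  by move=> x; rewrite inE orbC => ->.
have subl (l l' : seq nat) : {subset l <= l ++ l'}.
  by move=> x; rewrite mem_cat => ->.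
have subr (l l' : seq nat) : {subset l' <= l ++ l'}.
  by move=> x; rewrite mem_cat orbC => ->.
elim: s => [|k i e|e|s1 IH1 s2 IH2|x s1 IH1 s2 IH2|c k x s IH|k x s IH] /=.
- by [].
- by move=> _ st; apply: agree_upd; rewrite inE.
- by move=> _ st; split=> // hk; rewrite inE eqxx in hk.
- case/andP=> /IH1 h1 /IH2 h2 st; apply: (@agree_trans _ _ (denote s1 st)).
    exact: agree_sub (subl _ _) (h1 _).
  exact: agree_sub (subr _ _) (h2 _).
- case/and3P=> _ /IH1 h1 /IH2 h2 st; case: ifP => _.
    exact: agree_sub (subl _ _) (h1 _).
  exact: agree_sub (subr _ _) (h2 _).
- case/and4P=> _ _ _ /IH h st.
  apply: (@agree_trans _ _ (upd (upd st k 1 (eval_ex st x)) k 0 0)).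
    by apply: (@agree_trans _ _ (upd st k 1 (eval_ex st x))); apply: agree_upd;
      rewrite inE eqxx.
  apply: agree_iteri => j st'; apply: (@agree_trans _ _ (denote s st')).
    exact: agree_sub (sub1 _ _) (h _).
  by apply: agree_upd; rewrite inE eqxx.
- case/and4P=> _ _ _ /IH h st.
  apply: (@agree_trans _ _ (upd st k 0 (eval_ex st x))).
    by apply: agree_upd; rewrite inE eqxx.
  elim: (nbits _) => //= n IHn; apply: agree_trans IHn _.
  set st' := iter _ _ _; apply: (@agree_trans _ _ (denote s st')).
    exact: agree_sub (sub1 _ _) (h _).
  by apply: agree_upd; rewrite inE eqxx.
Qed.

(** * Simulation by the while-programs *)

Definition mem_ok (mem : seq nat) : Prop :=
  size mem <= n_arrays * A /\ all (fun v => v < V) mem.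

Definition represents (st : state) (mem : seq nat) : Prop :=
  forall k i, k < n_arrays -> nth 0 mem (n_arrays * i + k) = st k i.

Lemma bits_mem_ok mem : 0 < V -> mem_ok mem ->
  bits mem <= n_arrays * A * (trunc_log 2 V).+1.
Proof.
move=> V0 [sz /allP hv]; apply: leq_trans (leq_mul sz (leqnn _)).
rewrite /bits -sum1_size big_distrl /= !big_seq.
apply: leq_sum => v /hv hv'; rewrite mul1n ltnS.
by apply: leq_trunc_log; rewrite ltnW.
Qed.

Lemma eval_compile_ex st mem e : represents st mem -> wf_ex e -> eval F inp mem (compile_ex e) = eval_ex st e.
Proof.
move=> r; elim: e => //= [e IH /IH->|k e IH /andP[hk /IH->]|
   o e1 IH1 e2 IH2 /andP[/IH1-> /IH2->]|o e1 IH1 e2 IH2 /andP[/IH1-> /IH2->]] //.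
exact: r.
Qed.

Lemma represents_upd st mem k i v : k < n_arrays -> represents st mem ->
  represents (upd st k i v) (set_nth 0 mem (n_arrays * i + k) v).
Proof.
move=> hk r k' i' hk'; rewrite nth_set_nth /= .
have -> : (n_arrays * i' + k' == n_arrays * i + k) = (k' == k) && (i' == i).
  apply/eqP/andP => [e|[/eqP-> /eqP->] //].
  have ek : k' = k.
    by have := congr1 (modn^~ n_arrays) e; rewrite /= ![n_arrays * _]mulnC !modnMDl !modn_small.
  by move: e; rewrite ek => /addIn/eqP; rewrite eqn_mul2l /= => /eqP->.
by case: eqP => [->|_] /=; [case: eqP => // _|]; rewrite r.
Qed.

Lemma mem_ok_set mem k i v : k < n_arrays -> i < A -> v < V -> mem_ok mem ->
  mem_ok (set_nth 0 mem (n_arrays * i + k) v).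
Proof.
move=> hk hi hv [sz /allP al]; split.
  rewrite size_set_nth geq_max sz andbT -addnS.
  apply: (@leq_trans (n_arrays * i.+1)); last by rewrite leq_mul2l hi orbT.
  by rewrite mulnS addnC leq_add2r.
apply/allP=> x /(nthP 0)[j hj <-]; rewrite nth_set_nth /=; case: eqP => // _.
have [h|h] := ltnP j (size mem); first by apply/al/mem_nth.
by rewrite nth_default // (leq_ltn_trans _ hv).
Qed.

(** The memory is controlled at every intermediate configuration because [runs_within] bounds the
    space throughout the run. *)
Definition reach (s s' : config) (t : nat) : Prop :=
  exists n, [/\ n <= t, iter n (step F inp) s = s'
              & forall u, u <= n -> mem_ok (memory (iter u (step F inp) s))].

Lemma reach_trans s1 s2 s3 t1 t2 :
  reach s1 s2 t1 -> reach s2 s3 t2 -> reach s1 s3 (t1 + t2).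
Proof.
move=> [n1 [h1 e1 o1]] [n2 [h2 e2 o2]]; exists (n2 + n1); split.
- by rewrite addnC leq_add.
- by rewrite iterD e1.
move=> u; have [hu _|hu hu'] := leqP u n1; first exact: o1.
by rewrite -(subnK (ltnW hu)) iterD e1; apply: o2; lia.
Qed.

Lemma reach_step s s' : mem_ok (memory s) -> mem_ok (memory s') ->
  step F inp s = s' -> reach s s' 1.
Proof. by move=> h h' e; exists 1; split=> // [[|[|u]]] //=; rewrite e. Qed.

Lemma reach_weak s s' t t' : t <= t' -> reach s s' t -> reach s s' t'.
Proof. by move=> h [n [hn e o]]; exists n; split=> //; apply: leq_trans h. Qed.

Definition reaches st ks t s0 : Prop :=
  exists mem', [/\ represents st mem', mem_ok mem' & reach s0 (Config ks mem' (ou st)) t].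

Lemma step_set st mem k i e ks : k < n_arrays -> wf_ex i -> wf_ex e ->
  represents st mem -> mem_ok mem -> eval_ex st i < A -> eval_ex st e < V ->
  reaches (upd st k (eval_ex st i) (eval_ex st e)) ks 1
       (Config (assign k (compile_ex i) (compile_ex e) :: ks) mem (ou st)).
Proof.
move=> hk wi we r ok hi he.
exists (set_nth 0 mem (n_arrays * eval_ex st i + k) (eval_ex st e)); split.
- exact: represents_upd.
- exact: mem_ok_set.
- apply: reach_step => //=; first exact: mem_ok_set.
  by rewrite (eval_compile_ex r wi) (eval_compile_ex r we).
Qed.

Lemma reaches_trans st st' ks ks' t1 t2 s0 :
  reaches st ks t1 s0 ->
  (forall mem, represents st mem -> mem_ok mem -> reaches st' ks' t2 (Config ks mem (ou st))) ->
  reaches st' ks' (t1 + t2) s0.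
Proof.
move=> [m [r ok re]] /(_ m r ok)[m' [r' ok' re']].
by exists m'; split=> //; apply: reach_trans re re'.
Qed.

Lemma reaches_weak a b st ks s0 : a <= b -> reaches st ks a s0 -> reaches st ks b s0.
Proof. by move=> ab [m [? ? re]]; exists m; split=> //; apply: reach_weak re. Qed.

Hypothesis A1 : 1 < A.
Hypothesis V0 : 0 < V.

(** The compiled loop rereads its counter and bound from memory at each test; since the body leaves
    array k alone, they are the values fixed by [denote]. *)
Lemma iteri_bound_cell (s : stmt) k st n j : wf s -> k \notin mods s ->
  let st' := iteri j (fun j st => upd (denote s st) k 0 j.+1)
                   (upd (upd st k 1 n) k 0 0) in
  st' k 0 = j /\ st' k 1 = n.
Proof.
move=> w hk; elim: j => /= [|j [IH1 IH2]]; rewrite ?eqxx //=.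
by split=> //; rewrite (denote_agree w _).1.
Qed.

Lemma iter_half_cell (s : stmt) k st n j : wf s -> k \notin mods s ->
  let st' := iter j (fun st => let st' := denote s st in upd st' k 0 (st' k 0 %/ 2))
                   (upd st k 0 n) in
  st' k 0 = n %/ 2 ^ j.
Proof.
move=> w hk st'; rewrite {}/st'; elim: j => [|j IH]; first by rewrite /= !eqxx divn1.
rewrite iterS; move: IH; set st' := iter _ _ _ => IH.
by rewrite /= !eqxx (denote_agree w _).1 // IH -divnMA -expnSr.
Qed.

Lemma div_nbits n j : (n %/ 2 ^ j != 0) = (j < nbits n).
Proof.
rewrite /nbits; have [->|n0] := eqVneq n 0; first by rewrite div0n.
rewrite -lt0n divn_gt0 ?expn_gt0 // ltnS.
have [h|h] := leqP j (trunc_log 2 n).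
  apply: leq_trans (@trunc_logP 2 n isT _); last by rewrite lt0n.
  by rewrite leq_pexp2l.
apply/negbTE; rewrite -ltnNge; apply: leq_trans (@trunc_log_ltn 2 n isT) _.
by rewrite leq_pexp2l.
Qed.

(** Induction on s; for a loop, an inner induction on the number m of iterations still to be run. *)
Theorem compile_correct s : wf s -> forall st mem ks,
  safe s st -> represents st mem -> mem_ok mem ->
  reaches (denote s st) ks (time_bound M GB s) (Config (compile s :: ks) mem (ou st)).
Proof.
elim: s => [|k i e|e|s1 IH1 s2 IH2|x s1 IH1 s2 IH2|c k x s IH|k x s IH] /=.
- by move=> _ st mem ks _ r ok; exists mem; split=> //; apply: reach_step.
- case/and3P=> hk wi we st mem ks [hi he] r ok.
  by apply: step_set => //; apply: ltn_trans hk _.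
- move=> we st mem ks _ r ok; exists mem; split=> //; apply: reach_step => //=.
  by rewrite (eval_compile_ex r we).
- case/andP=> w1 w2 st mem ks [sf1 sf2] r ok.
  rewrite -addnA; apply: (@reaches_trans st _ [:: compile s1, compile s2 & ks]).
    by exists mem; split=> //; apply: reach_step.
  move=> m rm okm; apply: reaches_trans; first exact: IH1.
  by move=> m' r' ok'; apply: IH2.
- case/and3P=> wx w1 w2 st mem ks sf r ok; rewrite -addnA.
  apply: (@reaches_trans st _ ((if eval_ex st x != 0 then compile s1 else compile s2) :: ks)).
    by exists mem; split=> //; apply: reach_step => //=; rewrite (eval_compile_ex r wx).
  move=> m rm okm; case: ifP sf => _ sf.
    have [m' [r' ok' re']] := IH1 w1 st m ks sf rm okm.
    by exists m'; split=> //; apply: reach_weak re'; rewrite leq_addr.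
  have [m' [r' ok' re']] := IH2 w2 st m ks sf rm okm.
  by exists m'; split=> //; apply: reach_weak re'; rewrite leq_addl.
- case/and4P=> hk kn wx ws st mem ks [hV hB sf] r ok.
  have hkN : k < n_arrays by apply: ltn_trans hk _.
  set n := eval_ex st x in hV hB sf *.
  set st0 := upd (upd st k 1 n) k 0 0 in sf *.
  set f := fun j st => upd (denote s st) k 0 j.+1 in sf *.
  set B := Seq (compile s) _; set W := While _ B.
  have loop m : forall j, j + m = n -> forall mem, represents (iteri j f st0) mem -> mem_ok mem ->
      reaches (iteri n f st0) ks (m * (time_bound M GB s + 3) + 1)
           (Config (W :: ks) mem (ou (iteri j f st0))).
    elim: m => [|m IHm] j jm mem' r' ok'.
      have ejn : j = n by rewrite addn0 in jm.
      rewrite ejn in r' *; exists mem'; split=> //; apply: reach_step => //=.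
      have [c0 c1] := iteri_bound_cell st n n ws kn.
      by rewrite !muln1 (r' k 1) // (r' k 0) // -/st0 -/f c0 c1 ltnn.
    have jn : j < n by lia.
    have [c0 c1] := iteri_bound_cell st n j ws kn.
    apply: (reaches_weak (a := 1 + (1 + (time_bound M GB s + (1 + (m * (time_bound M GB s + 3) + 1)))))); first lia.
    apply: (@reaches_trans (iteri j f st0) _ [:: B, W & ks]).
      exists mem'; split=> //; apply: reach_step => //=.
      by rewrite (r' k 1) // (r' k 0) // c0 c1 jn.
    move=> m1 r1 ok1.
    apply: (@reaches_trans (iteri j f st0) _
      [:: compile s, assign k (Const 0) (NatOp NAdd (Fetch (addr k (Const 0))) (Const 1)), W & ks]).
      by exists m1; split=> //; apply: reach_step.
    move=> m2 r2 ok2.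
    apply: reaches_trans; first by apply: IH => //; apply: sf.
    move=> m3 r3 ok3.
    have ek : denote s (iteri j f st0) k 0 = j by rewrite (denote_agree ws _).1.
    apply: (@reaches_trans (iteri j.+1 f st0) _ (W :: ks)).
      have := @step_set (denote s (iteri j f st0)) m3 k (EC 0) (EN NAdd (EA k (EC 0)) (EC 1)) (W :: ks) hkN isT.
      rewrite /= hkN ek addn1; apply=> //; first by rewrite ltnW.
      by apply: leq_ltn_trans hV.
    by move=> m4 r4 ok4; apply: IHm => //; lia.
  have {}loop := loop n 0 (add0n _).
  have tt : n * (time_bound M GB s + 3) <= (if c then GB else M) * (time_bound M GB s + 3).
    by rewrite leq_mul2r hB orbT.
  apply: (reaches_weak (a := 1 + (1 + (1 + (1 + (n * (time_bound M GB s + 3) + 1)))))); first lia.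
  set S1 := assign k (Const 1) _; set S0 := assign k (Const 0) (Const 0).
  apply: (@reaches_trans st _ [:: S1, Seq S0 W & ks]).
    by exists mem; split=> //; apply: reach_step.
  move=> m1 r1 ok1; apply: (@reaches_trans (upd st k 1 n) _ (Seq S0 W :: ks)).
    exact: (@step_set _ m1 k (EC 1) x).
  move=> m2 r2 ok2; apply: (@reaches_trans (upd st k 1 n) _ [:: S0, W & ks]).
    by exists m2; split=> //; apply: reach_step.
  move=> m3 r3 ok3; apply: (@reaches_trans st0 _ (W :: ks)).
    by apply: (@step_set _ m3 k (EC 0) (EC 0)) => //=; rewrite ltnW.
  exact: loop.
- case/and4P=> hk kn wx ws st mem ks [hV hB sf] r ok.
  have hkN : k < n_arrays by apply: ltn_trans hk _.
  set n := eval_ex st x in hV hB sf *.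
  set st0 := upd st k 0 n in sf *.
  set f := fun st => _ in sf *.
  set B := Seq (compile s) _; set W := While _ B.
  have loop m : forall j, j + m = nbits n -> forall mem, represents (iter j f st0) mem ->
      mem_ok mem ->
      reaches (iter (nbits n) f st0) ks (m * (time_bound M GB s + 3) + 1)
           (Config (W :: ks) mem (ou (iter j f st0))).
    elim: m => [|m IHm] j jm mem' r' ok'.
      have ejn : j = nbits n by rewrite addn0 in jm.
      rewrite ejn in r' *; exists mem'; split=> //; apply: reach_step => //=.
      have c0 := iter_half_cell st n (nbits n) ws kn.
      by rewrite (r' k 0) // -/st0 -/f c0 div_nbits ltnn.
    have jn : j < nbits n by lia.
    have c0 := iter_half_cell st n j ws kn.
    apply: (reaches_weak (a := 1 + (1 + (time_bound M GB s + (1 + (m * (time_bound M GB s + 3) + 1)))))); first lia.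
    apply: (@reaches_trans (iter j f st0) _ [:: B, W & ks]).
      exists mem'; split=> //; apply: reach_step => //=.
      by rewrite (r' k 0) // c0 div_nbits jn.
    move=> m1 r1 ok1.
    apply: (@reaches_trans (iter j f st0) _
      [:: compile s, assign k (Const 0) (NatOp NDiv (Fetch (addr k (Const 0))) (Const 2)), W & ks]).
      by exists m1; split=> //; apply: reach_step.
    move=> m2 r2 ok2.
    apply: reaches_trans; first by apply: IH => //; apply: sf.
    move=> m3 r3 ok3.
    have ek : denote s (iter j f st0) k 0 = n %/ 2 ^ j by rewrite (denote_agree ws _).1.
    apply: (@reaches_trans (iter j.+1 f st0) _ (W :: ks)).
      have := @step_set (denote s (iter j f st0)) m3 k (EC 0) (EN NDiv (EA k (EC 0)) (EC 2)) (W :: ks) hkN isT.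
      rewrite /= hkN; apply=> //; first by rewrite ltnW.
      by rewrite ek; apply: leq_ltn_trans (leq_div _ _) (leq_ltn_trans (leq_div _ _) hV).
    by move=> m4 r4 ok4; apply: IHm => //; lia.
  have {}loop := loop (nbits n) 0 (add0n _).
  have tt : nbits n * (time_bound M GB s + 3) <= M * (time_bound M GB s + 3).
    by rewrite leq_mul2r hB orbT.
  apply: (reaches_weak (a := 1 + (1 + (nbits n * (time_bound M GB s + 3) + 1)))); first lia.
  set S0 := assign k (Const 0) _.
  apply: (@reaches_trans st _ [:: S0, W & ks]).
    by exists mem; split=> //; apply: reach_step.
  move=> m1 r1 ok1; apply: (@reaches_trans st0 _ (W :: ks)).
    by apply: (@step_set _ m1 k (EC 0) x) => //=; rewrite ltnW.
  exact: loop.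
Qed.

(** * Program logic *)

Definition wp (s : stmt) (Q : state -> Prop) (st : state) : Prop :=
  safe s st /\ Q (denote s st).

Lemma wp_post s (P Q : state -> Prop) st : wf s -> wp s P st ->
  (forall st', agree (mods s) st st' -> P st' -> Q st') -> wp s Q st.
Proof. by move=> w [h1 h2] h; split=> //; apply: h => //; apply: denote_agree. Qed.

Lemma wp_skip (Q : state -> Prop) st : Q st -> wp SSkip Q st.
Proof. by []. Qed.

Lemma wp_set k i e (Q : state -> Prop) st : eval_ex st i < A -> eval_ex st e < V ->
  Q (upd st k (eval_ex st i) (eval_ex st e)) -> wp (SSet k i e) Q st.
Proof. by []. Qed.

Lemma wp_seq s1 s2 (Q : state -> Prop) st :
  wp s1 (wp s2 Q) st -> wp (SSeq s1 s2) Q st.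
Proof. by case=> h1 [h2 h3]. Qed.

Lemma wp_if e s1 s2 (Q : state -> Prop) st :
  (eval_ex st e != 0 -> wp s1 Q st) -> (eval_ex st e = 0 -> wp s2 Q st) ->
  wp (SIf e s1 s2) Q st.
Proof.
rewrite /wp /=; have [->|n0] := eqVneq (eval_ex st e) 0; first by move=> _; apply.
by move=> /(_ isT).
Qed.

(** The invariant must survive writes to array k, which the loop performs between iterations.
    Unmodified arrays need no mention in it: the agreement with the entry state is supplied to the
    body and to the exit. *)
Lemma wp_for c k e s (I : nat -> state -> Prop) (Q : state -> Prop) st :
  wf (SFor c k e s) ->
  eval_ex st e < V -> eval_ex st e <= (if c then GB else M) ->
  I 0 st ->
  (forall j st' i v, I j st' -> I j (upd st' k i v)) ->
  (forall j st', j < eval_ex st e -> agree (k :: mods s) st st' -> st' k 0 = j ->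
     I j st' -> wp s (I j.+1) st') ->
  (forall st', agree (k :: mods s) st st' -> I (eval_ex st e) st' -> Q st') ->
  wp (SFor c k e s) Q st.
Proof.
move=> w hV hB I0 Iupd body fin; have [hk kn wx ws] := and4P w.
have inv j : j <= eval_ex st e -> let st' := iteri j (fun j st => upd (denote s st) k 0 j.+1)
     (upd (upd st k 1 (eval_ex st e)) k 0 0) in
   agree (k :: mods s) st st' /\ I j st'
   /\ (forall j', j' < j -> safe s (iteri j' (fun j st => upd (denote s st) k 0 j.+1)
     (upd (upd st k 1 (eval_ex st e)) k 0 0))).
  elim: j => [|j IH] hj.
    split; last by split=> //; exact/Iupd/Iupd.
    by apply: (@agree_trans _ _ (upd st k 1 (eval_ex st e))); apply: agree_upd;
       rewrite inE eqxx.
  have [ag [hI hS]] := IH (ltnW hj).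
  have [c0 c1] := iteri_bound_cell st (eval_ex st e) j ws kn.
  rewrite iteriS; set st' := iteri _ _ _ in ag hI c0 c1 *.
  have [sf hI'] := body j st' hj ag c0 hI.
  split; last first.
    split; first exact: Iupd.
    move=> j'; rewrite ltnS leq_eqVlt => /orP[/eqP->|/hS] //.
  apply: agree_trans ag _; apply: (@agree_trans _ _ (denote s st')).
    by apply: agree_sub (denote_agree ws _) => y; rewrite inE orbC => ->.
  by apply: agree_upd; rewrite inE eqxx.
have [ag [hI hS]] := inv _ (leqnn _).
by split; [split | apply: fin].
Qed.

Lemma wp_half k e s (I : nat -> state -> Prop) (Q : state -> Prop) st :
  wf (SHalf k e s) ->
  eval_ex st e < V -> nbits (eval_ex st e) <= M ->
  I 0 st ->
  (forall j st' i v, I j st' -> I j (upd st' k i v)) ->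
  (forall j st', agree (k :: mods s) st st' -> I j st' -> wp s (I j.+1) st') ->
  (forall st', agree (k :: mods s) st st' -> I (nbits (eval_ex st e)) st' -> Q st') ->
  wp (SHalf k e s) Q st.
Proof.
move=> w hV hB I0 Iupd body fin; have [hk kn wx ws] := and4P w.
have inv j : let st' := iter j (fun st => let st' := denote s st in
                                      upd st' k 0 (st' k 0 %/ 2))
     (upd st k 0 (eval_ex st e)) in
   agree (k :: mods s) st st' /\ I j st' /\ safe s st'.
  have sfI i st' : agree (k :: mods s) st st' -> I i st' ->
     agree (k :: mods s) st st' /\ I i st' /\ safe s st'.
    by move=> ag hI; split=> //; split=> //; have [] := body i st' ag hI.
  elim: j => [|j [ag [hI hS]]].
    by apply: sfI; [apply: agree_upd; rewrite inE eqxx | apply: Iupd].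
  rewrite iterS; set st' := iter _ _ _ in ag hI hS *.
  have [sf hI'] := body j st' ag hI.
  apply: sfI; last exact: Iupd.
  apply: agree_trans ag _; apply: (@agree_trans _ _ (denote s st')).
    by apply: agree_sub (denote_agree ws _) => y; rewrite inE orbC => ->.
  by apply: agree_upd; rewrite inE eqxx.
split; last by have [ag [hI _]] := inv (nbits (eval_ex st e)); apply: fin.
by split=> // j _; have [_ []] := inv j.
Qed.

End Sem.

(** * The chain ring F[x]/(x^H) *)

Section TruncPoly.

Local Open Scope ring_scope.

Variables (F : finFieldType) (H : nat).
Hypothesis H0 : (0 < H)%N.

Local Notation B := (truncpoly F H).

Definition cf (b : B) (h : nat) : F := (val b)`_h.

Definition mk (f : nat -> F) : B := in_qpoly _ (\poly_(h < H) f h).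

Lemma mk_monicH : mk_monic ('X^H : {poly F}) = 'X^H.
Proof. by rewrite mk_monic_Xn prednK. Qed.

Lemma cf_big (b : B) h : (H <= h)%N -> cf b h = 0.
Proof.
move=> hh; apply: nth_default; apply: leq_trans hh.
rewrite -ltnS; apply: leq_trans (size_mk_monic b) _.
by rewrite mk_monicH size_polyXn.
Qed.

Lemma cf_inj (a b : B) : (forall h, (h < H)%N -> cf a h = cf b h) -> a = b.
Proof.
move=> e; apply/val_inj/polyP => h; have [/e //|hh] := ltnP h H.
by have := cf_big a hh; have := cf_big b hh; rewrite /cf => -> ->.
Qed.

Lemma cf0 h : cf 0 h = 0. Proof. by rewrite /cf coef0. Qed.

Lemma cfD (a b : B) h : cf (a + b) h = cf a h + cf b h.
Proof. by rewrite /cf coefD. Qed.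

Lemma cfN (a : B) h : cf (- a) h = - cf a h.
Proof. by rewrite /cf coefN. Qed.

Lemma cfB (a b : B) h : cf (a - b) h = cf a h - cf b h.
Proof. by rewrite cfD cfN. Qed.

Lemma cf1 h : cf 1 h = (h == 0%N)%:R.
Proof. by rewrite /cf /= coefC; case: eqP. Qed.

Lemma cf_natr n h : cf n%:R h = if h == 0%N then n%:R else 0.
Proof.
elim: n => [|n IH]; first by rewrite cf0 if_same.
by rewrite -!natr1 cfD IH cf1; case: (h == 0%N); rewrite ?addr0.
Qed.

Lemma coef_rmodXn (p : {poly F}) h : (h < H)%N ->
  (Pdiv.CommonRing.rmodp p (mk_monic ('X^H : {poly F})))`_h = p`_h.
Proof.
move=> hh; rewrite mk_monicH [p in RHS](Pdiv.RingMonic.rdivp_eq (monicXn _ H)).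
by rewrite coefD coefMXn hh add0r.
Qed.

Lemma cf_mk f h : (h < H)%N -> cf (mk f) h = f h.
Proof.
by move=> hh; rewrite /cf /= coef_rmodXn // coef_poly hh.
Qed.

Lemma cfM (a b : B) h : (h < H)%N ->
  cf (a * b) h = \sum_(l < h.+1) cf a l * cf b (h - l).
Proof. by move=> hh; rewrite /cf /= coef_rmodXn // coefM. Qed.

Definition mono (k : nat) (c : F) : B := mk (fun j => if j == k then c else 0).

Lemma cf_monoM k c (b : B) h : (h < H)%N ->
  cf (mono k c * b) h = if (k <= h)%N then c * cf b (h - k) else 0.
Proof.
move=> hh; rewrite cfM //.
have E (l : 'I_h.+1) : cf (mono k c) l * cf b (h - l) =
    if (l : nat) == k then c * cf b (h - k) else 0.
  rewrite cf_mk; last by apply: leq_trans hh; apply: ltn_ord.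
  by case: eqP => [->|_]; rewrite ?mul0r.
rewrite (eq_bigr _ (fun l _ => E l)) -big_mkcond /=.
have [kh|kh] := leqP k h.
  by rewrite (big_pred1 (Ordinal (kh : (k < h.+1)%N))) //.
rewrite big_pred0 // => l; apply/negbTE; rewrite neq_ltn.
by rewrite (leq_trans (ltn_ord l)).
Qed.

(* Long division by p, meaningful when p has valuation h. *)
Definition quo_step (h : nat) (p : B) (k : nat) (sw : B * B) : B * B :=
  let c := cf sw.1 (h + k) / cf p h in
  (sw.1 - mono k c * p, sw.2 + mono k c).

Definition quo (h : nat) (s p : B) : B :=
  (iteri (H - h) (quo_step h p) (s, 0)).2.

Lemma quo_sub h s p n :
  (iteri n (quo_step h p) (s, 0)).1 = s - (iteri n (quo_step h p) (s, 0)).2 * p.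
Proof.
elim: n => [|n IH]; first by rewrite /= mul0r subr0.
move: IH; rewrite iteriS; case: (iteri _ _ _) => a b /= ->.
by rewrite mulrDl opprD addrA.
Qed.

(** Step k cancels coefficient h + k of the remainder and touches none below it, so H - h steps
    leave 0. *)
Lemma quoP h s p : (forall j, (j < h)%N -> cf s j = 0) ->
  (forall j, (j < h)%N -> cf p j = 0) -> cf p h != 0 -> s = quo h s p * p.
Proof.
move=> s0 p0 ph.
have hH : (h < H)%N by rewrite ltnNge; apply/negP => /(cf_big p) e; rewrite e eqxx in ph.
have inv n : (n <= H - h)%N ->
    forall j, (j < h + n)%N -> cf (iteri n (quo_step h p) (s, 0)).1 j = 0.
  elim: n => [_ j|n IH hn]; first by rewrite addn0; apply: s0.
  have {}IH := IH (ltnW hn).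
  rewrite iteriS; case: (iteri n _ _) IH => a b /= IH j.
  rewrite addnS ltnS leq_eqVlt => hj.
  have jH : (j < H)%N.
    by rewrite -(subnKC (ltnW hH)); case/orP: hj => [/eqP->|/ltn_trans];
      rewrite ?ltn_add2l //; apply; rewrite ltn_add2l.
  rewrite cfB cf_monoM //; case/orP: hj => [/eqP ej|hj].
    by rewrite ej leq_addl addnK mulfVK // subrr.
  rewrite IH // sub0r; case: ifP => [nj|]; last by rewrite oppr0.
  by rewrite (p0 (j - n)%N) ?mulr0 ?oppr0 //; lia.
apply/eqP; rewrite -subr_eq0 /quo -quo_sub; apply/eqP/cf_inj => j jH.
by rewrite cf0; apply: inv => //; rewrite subnKC // ltnW.
Qed.

Lemma valuation (a : B) : a != 0 ->
  exists2 h, cf a h != 0 & forall j, (j < h)%N -> cf a j = 0.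
Proof.
move=> a0; have ex : exists h, cf a h != 0.
  have : ~~ [forall h : 'I_H, cf a h == 0].
    apply: contra a0 => /forallP e; apply/eqP/cf_inj => h hh.
    by rewrite cf0; apply/eqP; apply: (e (Ordinal hh)).
  by rewrite negb_forall => /existsP[h hh]; exists h.
exists (ex_minn ex); first by case: ex_minnP.
case: ex_minnP => m _ hm j jm; apply/eqP; apply: contraLR jm => /hm.
by rewrite -leqNgt.
Qed.

(** The element of smaller valuation divides the other. *)
Lemma chain (a b : B) : (exists c, b = c * a) \/ (exists c, a = c * b).
Proof.
have [->|a0] := eqVneq a 0; first by right; exists 0; rewrite mul0r.
have [->|b0] := eqVneq b 0; first by left; exists 0; rewrite mul0r.
have [h ah al] := valuation a0; have [k bk bl] := valuation b0.
have [hk|kh] := leqP h k.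
  by left; exists (quo h b a); apply: quoP => // j jh; apply: bl; apply: leq_trans hk.
right; exists (quo k a b); apply: quoP => // j jh; apply: al; apply: ltn_trans kh => //.
Qed.

(** Otherwise x = t y by [chain]. If t is a unit, invert it. If not, c x = t q c x with 1 - t q a
    unit, which forces c x = 0. *)
Lemma dvd_cancel (c x y q : B) : c * y = q * (c * x) -> c * x != 0 ->
  exists k, y = k * x.
Proof.
move=> e nz; have [//|[t xt]] := chain x y.
have [t0|t0] := eqVneq (cf t 0) 0; last first.
  have u : 1 = quo 0 1 t * t by apply: quoP.
  by exists (quo 0 1 t); rewrite xt mulrA -u mul1r.
case/eqP: nz; have u : 1 = quo 0 1 (1 - t * q) * (1 - t * q).
  apply: quoP => //.
  by rewrite cfB cf1 cfM // big_ord1 t0 mul0r subr0 oner_eq0.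
rewrite -[LHS]mul1r u -mulrA; set Q := quo _ _ _.
have -> : (1 - t * q) * (c * x) = 0; last by rewrite mulr0.
by rewrite mulrBl mul1r -mulrA -e mulrCA -xt subrr.
Qed.

(** * Rank reduction over the chain ring *)

Definition factors (n N : nat) (M : nat -> nat -> B) (r : nat) : Prop :=
  exists (a : nat -> nat -> B) (k : nat -> nat -> B), forall i p,
    (i < n)%N -> (p < N)%N -> M i p = \sum_(s < r) a i s * k s p.

(** Quotients are unique only up to annihilators, so [g s = 1] does not follow from the
    divisibilities and is asked for separately. *)
Lemma chain_min r (f : nat -> B) :
  exists (s : 'I_r.+1) (g : nat -> B),
    g s = 1 /\ forall t, (t < r.+1)%N -> f t = g t * f s.
Proof.
elim: r => [|r [s [g [gs hg]]]].
  by exists ord0, (fun=> 1); split=> // t; rewrite ltnS leqn0 => /eqP->; rewrite mul1r.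
have [[c ec]|[c ec]] := chain (f s) (f r.+1).
  exists (widen_ord (leqnSn _) s), (fun t => if t == r.+1 then c else g t).
  split=> [|t]; first by rewrite /= ltn_eqF.
  rewrite ltnS leq_eqVlt => /orP[/eqP->|tr]; first by rewrite eqxx.
  by rewrite ltn_eqF // hg.
exists ord_max, (fun t => if t == r.+1 then 1 else g t * c); rewrite /= eqxx.
split=> // t; rewrite ltnS leq_eqVlt => /orP[/eqP->|tr].
  by rewrite eqxx mul1r.
by rewrite ltn_eqF // -mulrA -ec hg.
Qed.

(* Over a field this is Wedderburn's rank reduction.  Over the chain ring, let
   row i of the left factor have its most divisible entry at s, so that row i
   of the product is a i s times a row vector ka.  As M i p divides row i of M,
   ka p divides ka (dvd_cancel), and the vanishing of column p of the reduced
   matrix expresses the s-th summand through the others. *)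
Lemma rank_reduction n N M r i p (w : nat -> B) :
  (i < n)%N -> (p < N)%N ->
  (forall i', (i' < n)%N -> M i' p = w i' * M i p) ->
  (forall p', (p' < N)%N -> exists c, M i p' = c * M i p) ->
  M i p != 0 ->
  factors n N M r ->
  exists2 r', r = r'.+1 & factors n N (fun i' p' => M i' p' - w i' * M i p') r'.
Proof.
move=> hi hp hw hdiv nz [a [k e]].
case: r e => [|r] e; first by rewrite e // big_ord0 eqxx in nz.
exists r => //; have [s [g [gs hg]]] := chain_min r (a i).
pose ka p' := \sum_(t < r.+1) g t * k t p'.
have Mi p' : (p' < N)%N -> M i p' = a i s * ka p'.
  move=> hp'; rewrite e // big_distrr; apply: eq_bigr => t _ /=.
  by rewrite hg // mulrA [a i s * _]mulrC.
have kdiv p' : (p' < N)%N -> exists c, ka p' = c * ka p.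
  move=> hp'; have [q eq] := hdiv p' hp'; rewrite !Mi // in eq.
  by apply: dvd_cancel eq _; rewrite -Mi.
(* Finite choice of the quotients, by induction on N. *)
have [d hd] : exists d : nat -> B, forall p', (p' < N)%N -> ka p' = d p' * ka p.
  have : forall p', exists c, (p' < N)%N -> ka p' = c * ka p.
    move=> p'; have [/kdiv[c ec]|_] := ltnP p' N; first by exists c.
    by exists 0.
  clear -N; elim: N => [|m IH] h; first by exists (fun=> 0).
  have [d hd] := IH (fun p' => let: ex_intro c hc := h p' in
                               ex_intro _ c (fun hp => hc (leqW hp))).
  have [c hc] := h m; exists (fun p' => if p' == m then c else d p') => p'.
  rewrite ltnS leq_eqVlt => /orP[/eqP->|pm]; first by rewrite eqxx; apply: hc.
  by rewrite ltn_eqF // hd.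
(* [bump s] enumerates the indices other than s; [k s] is traded for [ka], in which its coefficient
   g s is 1. *)
pose a' i' t := a i' (bump s t) - g (bump s t) * a i' s.
have Mw i' p' : (i' < n)%N -> (p' < N)%N ->
    M i' p' - w i' * M i p' =
    (a i' s - w i' * a i s) * ka p' + \sum_(t < r) a' i' t * k (bump s t) p'.
  move=> hi' hp'; rewrite (Mi p') // (e i' p') // (bigD1_ord s) //=.
  have -> : k s p' = ka p' - \sum_(t < r) g (bump s t) * k (bump s t) p'.
    by rewrite /ka (bigD1_ord s) //= gs mul1r addrK.
  have -> : \sum_(t < r) a' i' t * k (bump s t) p' =
      \sum_(t < r) a i' (bump s t) * k (bump s t) p' -
      a i' s * (\sum_(t < r) g (bump s t) * k (bump s t) p').
    rewrite big_distrr -sumrB; apply: eq_bigr => t _ /=.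
    by rewrite mulrBl mulrCA mulrA.
  by rewrite mulrBr mulrBl mulrA; ring.
exists a', (fun t p' => k (bump s t) p' - d p' * k (bump s t) p) => i' p' hi' hp'.
rewrite Mw // hd //.
(* In column p the reduced matrix is 0, so the [ka p] term is a combination of the r others;
   multiplying by [d p'] carries this to column p'. *)
have := Mw i' p hi' hp; rewrite -hw // subrr => /esym/eqP.
rewrite addr_eq0 => /eqP E.
rewrite [d p' * _]mulrC mulrA E mulNr mulrC big_distrr -sumrN -big_split /=.
by apply: eq_bigr => t _; rewrite mulrBr addrC; congr (_ - _); rewrite mulrCA.
Qed.

End TruncPoly.

(** * Flattened multi-indices *)

Section Positions.

Variables (D : nat) (nn : nat -> nat).

(** Tensors become functions of a row-major position p < N, as in the input; [sz d] counts the
    positions sharing given indices on the first d axes. *)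
Definition sz (d : nat) := \prod_(d <= e < D) nn e.
Definition stride (d : nat) := sz d.+1.
Definition idx (d p : nat) := (p %/ stride d) %% nn d.
(** The truncated subtraction is exact by [pos_split]; this is the formula that the program
    evaluates. *)
Definition set_idx (d p i : nat) := p - idx d p * stride d + i * stride d.

Local Notation N := (sz 0).

Lemma szE d : d < D -> sz d = nn d * stride d.
Proof. by move=> hd; rewrite /sz big_ltn. Qed.

Lemma sz_dvd d e : d <= e -> e <= D -> sz e %| sz d.
Proof.
by move=> de eD; rewrite /sz (big_cat_nat de eD) /= dvdn_mull.
Qed.

Lemma szD : sz D = 1. Proof. by rewrite /sz big_geq. Qed.

Section At.

Variables (d p : nat).
Hypotheses (hd : d < D) (hp : p < N).

Lemma sz_gt0 : 0 < sz d.
Proof. by apply: dvdn_gt0 (sz_dvd (leq0n _) (ltnW hd)); apply: leq_ltn_trans hp. Qed.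

Lemma nn_gt0 : 0 < nn d.
Proof. by have := sz_gt0; rewrite szE // muln_gt0 => /andP[]. Qed.

Lemma stride_gt0 : 0 < stride d.
Proof. by have := sz_gt0; rewrite szE // muln_gt0 => /andP[]. Qed.

Lemma idx_lt : idx d p < nn d.
Proof. by rewrite ltn_mod nn_gt0. Qed.

Lemma pos_split : p = p %/ sz d * sz d + idx d p * stride d + p %% stride d.
Proof.
rewrite {1}(divn_eq p (stride d)) {1}(divn_eq (p %/ stride d) (nn d)) -divnMA.
by rewrite mulnDl -mulnA [stride d * _]mulnC -szE.
Qed.

Lemma set_idxE i : set_idx d p i = p %/ sz d * sz d + i * stride d + p %% stride d.
Proof. by rewrite /set_idx {1}pos_split addnAC addnK addnAC. Qed.

Lemma set_idx_id : set_idx d p (idx d p) = p.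
Proof. by rewrite set_idxE -pos_split. Qed.

Variable i : nat.
Hypothesis hi : i < nn d.

Lemma low_lt : i * stride d + p %% stride d < sz d.
Proof.
rewrite szE //; apply: (@leq_trans (i.+1 * stride d)); last by rewrite leq_mul2r hi orbT.
by rewrite mulSn [stride d + _]addnC ltn_add2l ltn_mod stride_gt0.
Qed.

Lemma set_idx_div : set_idx d p i %/ sz d = p %/ sz d.
Proof. by rewrite set_idxE -addnA divnMDl ?sz_gt0 // (divn_small low_lt) addn0. Qed.

Lemma set_idx_div_stride : set_idx d p i %/ stride d = p %/ sz d * nn d + i.
Proof.
rewrite set_idxE szE // mulnA -mulnDl divnMDl ?stride_gt0 //.
by rewrite [_ %% _ %/ _]divn_small ?addn0 // ltn_mod stride_gt0.
Qed.

Lemma set_idx_lt : set_idx d p i < N.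
Proof.
have h0 := sz_dvd (leq0n d) (ltnW hd).
have e := divnK h0; rewrite -e.
apply: (@leq_trans ((p %/ sz d).+1 * sz d)).
  by rewrite set_idxE -addnA mulSnr ltn_add2l low_lt.
by rewrite leq_mul2r ltn_divLR ?sz_gt0 // e hp orbT.
Qed.

Lemma idx_set_idx : idx d (set_idx d p i) = i.
Proof. by rewrite /idx set_idx_div_stride modnMDl modn_small. Qed.

(** For e < d the index depends only on the quotient by [sz d], which is kept; for e > d the
    position changes by a multiple of [sz e]. *)
Lemma idx_set_idx_ne e : e < D -> e != d -> idx e (set_idx d p i) = idx e p.
Proof.
move=> he; rewrite neq_ltn => /orP[ed|de].
  have dv : sz d %| stride e by apply: sz_dvd => //; apply: ltnW.
  have q := divnK dv.
  by rewrite /idx -q [_ * sz d]mulnC !divnMA set_idx_div.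
have dv : sz e %| stride d by apply: sz_dvd => //; apply: ltnW.
have [c ec] := dvdnP dv.
have se : 0 < stride e.
  apply: dvdn_gt0 (sz_dvd (leq0n _) he); exact: leq_ltn_trans hp.
rewrite /idx set_idxE [in RHS]pos_split szE // mulnA -!mulnDl ec szE //.
by rewrite !mulnA !divnMDl // !modnMDl.
Qed.

Lemma set_idx_set_idx j : set_idx d (set_idx d p i) j = set_idx d p j.
Proof.
by rewrite {1}/set_idx idx_set_idx {1}/set_idx addnK.
Qed.

End At.

Lemma pos_sum p : p < N -> \sum_(0 <= d < D) idx d p * stride d = p.
Proof.
move=> hp.
have T d : d <= D -> \sum_(0 <= e < d) idx e p * stride e + p %% sz d = p.
  elim: d => [_|d IH hd]; first by rewrite big_geq // modn_small.
  rewrite big_nat_recr //= -[RHS](IH (ltnW hd)) -addnA; congr (_ + _).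
  rewrite -/(stride d) [in RHS](pos_split p hd) -addnA modnMDl [RHS]modn_small //.
  by apply: (low_lt hd hp); apply: idx_lt hp.
by have := T D (leqnn _); rewrite szD modn1 addn0.
Qed.

End Positions.

(** * Elimination of one unfolding *)

Section Elimination.

Local Open Scope ring_scope.

Variables (F : finFieldType) (H : nat).
Hypothesis H0 : (0 < H)%N.
Local Notation B := (truncpoly F H).

Variables (n N : nat).

(** The row operation of a pivot, separated from the matrix so that it can be replayed on the
    vectors of a CPD. *)
Definition reduce1 (iw : nat * (nat -> B)) (v : nat -> B) : nat -> B :=
  fun i' => v i' - iw.2 i' * v iw.1.

Definition reduce (tr : seq (nat * (nat -> B))) (v : nat -> B) : nat -> B :=
  foldl (fun v iw => reduce1 iw v) v tr.

(* The current matrix and the list of the pivots met so far: a pivot in row i,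
   column p is recorded as i together with column p divided by its entry i. *)
Definition elim_state := ((nat -> nat -> B) * seq (nat * (nat -> B)))%type.

Definition pivot (h p i : nat) (x : elim_state) : nat -> B :=
  fun i' => quo h (x.1 i' p) (x.1 i p).

Definition elim_step (h p i : nat) (x : elim_state) : elim_state :=
  if cf (x.1 i p) h == 0 then x
  else (fun i' p' => x.1 i' p' - pivot h p i x i' * x.1 i p',
        rcons x.2 (i, pivot h p i x)).

(** Scanning the valuations h in increasing order in the outermost loop gives pivots of minimal
    valuation with no search for a minimum. *)
Definition elim_fiber h p := iteri n (elim_step h p).
Definition elim_val h := iteri N (fun p => elim_fiber h p).
Definition elim (M : nat -> nat -> B) : elim_state := iteri H elim_val (M, [::]).

Variables (M0 : nat -> nat -> B).

Lemma iteri_inv {T} (I : nat -> T -> Prop) (f : nat -> T -> T) (m : nat) x :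
  I 0%N x -> (forall j x, (j < m)%N -> I j x -> I j.+1 (f j x)) -> I m (iteri m f x).
Proof.
move=> h0 hs; have : forall k, (k <= m)%N -> I k (iteri k f x).
  by elim=> //= k IH hk; apply: hs => //; apply: IH; apply: ltnW.
exact.
Qed.

(** The potential behind the bound n on the number of pivots: a pivot annihilates its row, and zero
    rows stay zero. *)
Definition nzrows (M : nat -> nat -> B) : nat :=
  (\sum_(i < n) [exists p : 'I_N, M i p != 0%R])%N.

(** The second clause says that the trace alone replays the elimination; the last two bound its
    length by n and by the size of any factorization of the initial matrix. *)
Definition elim_inv (x : elim_state) : Prop :=
  [/\ all (fun iw => iw.1 < n)%N x.2, forall p, x.1^~ p = reduce x.2 (M0^~ p),
      (size x.2 + nzrows x.1 <= n)%N
    & forall r, factors n N M0 r ->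
        (size x.2 <= r)%N /\ factors n N x.1 (r - size x.2)].

Definition low (h : nat) (x : elim_state) : Prop :=
  forall i p j, (i < n)%N -> (p < N)%N -> (j < h)%N -> cf (x.1 i p) j = 0.

Definition cleared (h m : nat) (x : elim_state) : Prop :=
  forall i p, (i < n)%N -> (p < m)%N -> cf (x.1 i p) h = 0.

Lemma pivotP h p i x i' : (p < N)%N -> (i < n)%N -> (i' < n)%N -> low h x ->
  cf (x.1 i p) h != 0 -> x.1 i' p = pivot h p i x i' * x.1 i p.
Proof. by move=> hp hi hi' lw nz; apply: quoP => // j jh; apply: lw. Qed.

(** Under [low], the pivot divides its whole row. If entry p' of the row is c times the pivot, entry
    (i', p') changes by c times entry (i', p), so no valuation drops below h; and a column whose
    entries vanish at h receives multiples of such an entry. *)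
Lemma elim_step_inv h p i x : (h < H)%N -> (p < N)%N -> (i < n)%N ->
  elim_inv x -> low h x ->
  [/\ elim_inv (elim_step h p i x), low h (elim_step h p i x),
      forall m, (m <= N)%N -> cleared h m x -> cleared h m (elim_step h p i x),
      forall i', (i' < n)%N -> cf (x.1 i' p) h = 0 -> cf ((elim_step h p i x).1 i' p) h = 0
    & cf ((elim_step h p i x).1 i p) h = 0].
Proof.
move=> hh hp hi [al ap cnt fac] lw.
have [z|nz] := eqVneq (cf (x.1 i p) h) 0; first by rewrite /elim_step z eqxx.
have E := pivotP hp hi _ lw nz.
have Mnz : x.1 i p != 0 by apply: contra nz => /eqP->; rewrite cf0.
have dv p' : (p' < N)%N -> exists c, x.1 i p' = c * x.1 i p.
  by move=> hp'; exists (quo h (x.1 i p') (x.1 i p)); apply: quoP => // j jh; apply: lw.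
have rowi p' : (p' < N)%N -> x.1 i p' - pivot h p i x i * x.1 i p' = 0.
  by move=> /dv[c ->]; rewrite mulrCA -E // subrr.
have zrow i' : (i' < n)%N -> (forall p', (p' < N)%N -> x.1 i' p' = 0) ->
    forall p', (p' < N)%N -> x.1 i' p' - pivot h p i x i' * x.1 i p' = 0.
  move=> hi' zr p' hp'; rewrite zr // sub0r; have [c ->] := dv p' hp'.
  by rewrite mulrCA -E // zr // mulr0 oppr0.
rewrite /elim_step (negPf nz); split.
- split=> /=.
  + by rewrite all_rcons hi.
  + by move=> p'; rewrite /reduce foldl_rcons -/(reduce _ _) -ap.
  + apply: leq_trans cnt; rewrite size_rcons addSnnS leq_add2l /nzrows.
    rewrite (bigD1 (Ordinal hi)) //= [X in (_ <= X)%N](bigD1 (Ordinal hi)) //=.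
    have -> : [exists p' : 'I_N, x.1 i p' - pivot h p i x i * x.1 i p' != 0] = false.
      by apply/existsP=> -[p']; rewrite rowi ?eqxx.
    have -> : [exists p' : 'I_N, x.1 i p' != 0] by apply/existsP; exists (Ordinal hp).
    rewrite add0n ltnS; apply: leq_sum => i' _.
    case: existsP => // -[p' nz']; case: existsP => // ne; case/eqP: nz'.
    apply: zrow => // p'' hp''; apply/eqP/negPn/negP => nz'.
    by case: ne; exists (Ordinal hp'').
  + move=> r /fac[sr fr]; rewrite size_rcons.
    have [r' er fr'] := rank_reduction H0 hi hp E dv Mnz fr.
    by split; [lia | rewrite (_ : (r - (size x.2).+1)%N = r') //; lia].
- move=> i' p' j hi' hp' jh /=; have [c ->] := dv p' hp'.
  rewrite mulrCA -E // cfB lw // sub0r cfM ?(ltn_trans jh) //.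
  rewrite big1 ?oppr0 // => l _; rewrite lw ?mulr0 //; lia.
- move=> m hm cl i' p' hi' hp' /=.
  have hp'' := leq_trans hp' hm.
  rewrite cfB cl // sub0r cfM // big1 ?oppr0 // => l _.
  case: (posnP l) => [->|l0]; first by rewrite subn0 cl ?mulr0.
  by rewrite lw ?mulr0 //; have := ltn_ord l; lia.
- by move=> i' hi' z /=; rewrite -E // subrr cf0.
- by rewrite /= -E // subrr cf0.
Qed.

(** The invariants nest like the loops: the round at h makes all entries divisible by one more power
    of x, and after H rounds they are 0. *)
Lemma elimP : let x := elim M0 in
  elim_inv x /\ forall i p, (i < n)%N -> (p < N)%N -> x.1 i p = 0.
Proof.
have init : elim_inv (M0, [::]).
  split=> //=; last by move=> r; rewrite subn0.
  rewrite add0n /nzrows -[leqRHS]card_ord -sum1_card.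
  by apply: leq_sum => i _; case: existsP.
suff [ei lw] : elim_inv (elim M0) /\ low H (elim M0).
  by split=> // i p hi hp; apply: cf_inj => // h hh; rewrite lw // cf0.
pose I h x := elim_inv x /\ low h x.
suff : I H (iteri H elim_val (M0, [::])) by [].
apply: iteri_inv; first by split.
move=> h x hh Ix; pose I1 p x := I h x /\ cleared h p x.
have : I1 N (iteri N (fun p => elim_fiber h p) x).
  apply: iteri_inv; first by split=> // i p.
  move=> p {Ix}x hp [Ix cl].
  pose I2 i x := I1 p x /\ forall i', (i' < i)%N -> cf (x.1 i' p) h = 0.
  have : I2 n (iteri n (elim_step h p) x).
    apply: iteri_inv; first by split.
    move=> i {Ix cl}x hi [[[ei lw] cl] cp].
    have [e1 l1 c1 k1 z1] := elim_step_inv hh hp hi ei lw.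
    split; first by split=> //; apply: c1 => //; apply: ltnW.
    move=> i'; rewrite ltnS leq_eqVlt => /orP[/eqP->|hi'] //.
    by apply: k1; [apply: ltn_trans hi | apply: cp].
  move=> [[I' cl'] cp]; split=> // i p' hi.
  by rewrite ltnS leq_eqVlt => /orP[/eqP->|]; [apply: cp | apply: cl'].
move=> [[e lw] cl]; split=> // i p j hi hp.
by rewrite ltnS leq_eqVlt => /orP[/eqP->|]; [apply: cl | apply: lw].
Qed.

(** Linearity, in the form that passes from a fiber of the tensor to the vectors of a CPD. *)
Lemma reduce_sum tr r (a : nat -> nat -> B) (k : nat -> B) i :
  reduce tr (fun i => \sum_(s < r) a i s * k s) i = \sum_(s < r) reduce tr (a^~ s) i * k s.
Proof.
elim/last_ind: tr i => [//|tr iw IH] i.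
rewrite /reduce foldl_rcons -/(reduce _ _) /reduce1 !IH big_distrr -sumrB.
apply: eq_bigr => s _; rewrite foldl_rcons -/(reduce _ _) /= /reduce1 mulrBl.
by rewrite mulrA.
Qed.

Lemma reduce_ext tr v v' : all (fun iw => iw.1 < n)%N tr ->
  (forall i, (i < n)%N -> v i = v' i) ->
  forall i, (i < n)%N -> reduce tr v i = reduce tr v' i.
Proof.
elim: tr v v' => [|[j w] tr IH] v v'; first by move=> _ e i hi; apply: e.
case/andP=> /= hj al e i hi.
by apply: IH => // k hk; rewrite /reduce1 /= !e.
Qed.

End Elimination.

(** * Guessing and peeling rank-one terms *)

Section Search.

Local Open Scope ring_scope.

Variables (F : finFieldType) (H : nat).
Hypothesis H0 : (0 < H)%N.
Local Notation B := (truncpoly F H).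
Local Notation q := #|F|.

Definition guess_elt (g : nat) : B := mk H (fun h => decode F (g %/ q ^ h %% q)).

Lemma cardF_gt0 : (0 < q)%N. Proof. by apply/card_gt0P; exists 0. Qed.

Lemma code_lt (a : F) : (code a < q)%N.
Proof. by rewrite /code cardE index_mem mem_enum. Qed.

Lemma codeK : cancel (@code F) (decode F).
Proof. by move=> a; rewrite /decode nth_index ?mem_enum. Qed.

Lemma decodeK m : (m < q)%N -> code (decode F m) = m.
Proof. by move=> hm; rewrite /code index_uniq ?enum_uniq // -cardE. Qed.

Lemma digits (f : nat -> nat) m g' : (forall h, f h < q)%N ->
  exists2 g, (g %/ q ^ m = g')%N & forall h, (h < m)%N -> (g %/ q ^ h %% q = f h)%N.
Proof.
move=> hf; elim: m g' => [|m IH] g'; first by exists g'; rewrite ?divn1.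
have [g eg hg] := IH (g' * q + f m)%N; exists g.
  by rewrite expnSr divnMA eg divnMDl ?cardF_gt0 // divn_small ?addn0.
move=> h; rewrite ltnS leq_eqVlt => /orP[/eqP->|]; last exact: hg.
by rewrite eg modnMDl modn_small.
Qed.

Lemma guess_elt_ex (y : B) g' : exists2 g, (g %/ q ^ H = g')%N & guess_elt g = y.
Proof.
have [g eg hg] := @digits (fun h => code (cf y h)) H g' (fun h => code_lt _).
exists g => //; apply: cf_inj => // h hh.
by rewrite cf_mk // hg // codeK.
Qed.

Definition cstep (ag : (nat -> B) * nat) (iw : nat * (nat -> B)) : (nat -> B) * nat :=
  (fun i => ag.1 i + iw.2 i * guess_elt ag.2, (ag.2 %/ q ^ H)%N).

(* Each pivot reads one ring element of the guess.  By consume_ex, a suitable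
   guess turns this into the projection of a prescribed vector v along the
   elimination, v - reduce tr v. *)
Definition consume (tr : seq (nat * (nat -> B))) (g : nat) : (nat -> B) * nat :=
  foldl cstep (fun=> 0, g) tr.

Lemma consume_div tr ag : (foldl cstep ag tr).2 = (ag.2 %/ q ^ (H * size tr))%N.
Proof.
elim: tr ag => [|iw tr IH] ag; first by rewrite /= muln0 divn1.
by rewrite /= IH /= -divnMA -expnD mulnS.
Qed.

(** The difference v - reduce tr v telescopes: a pivot (j, w) contributes w times coordinate j of v
    as reduced so far, and the guess supplies this coordinate. *)
Lemma consume_ex tr (v : nat -> B) g' a : exists g,
  (foldl cstep (a, g) tr).2 = g' /\
  forall i, (foldl cstep (a, g) tr).1 i = a i + (v i - reduce tr v i).
Proof.
elim: tr v a => [|[j w] tr IH] v a /=.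
  by exists g'; split=> // i; rewrite subrr addr0.
have [g1 [e1 h1]] := IH (reduce1 (j, w) v) (fun i => a i + w i * v j).
have [g eg hy] := guess_elt_ex (v j) g1.
exists g; rewrite /cstep /= hy eg; split=> // i.
by rewrite h1 /reduce1 /=; ring.
Qed.

Variables (D : nat) (nn : nat -> nat).
Local Notation N := (sz D nn 0).
Local Notation stride := (stride D nn).
Local Notation idx := (idx D nn).
Local Notation set_idx := (set_idx D nn).

(* The unfolding along axis d, with every column repeated: its columns are
   indexed by the positions p, whose index along d is ignored. *)
Definition fibers (t : nat -> B) (d i p : nat) : B := t (set_idx d p i).

Definition trace (t : nat -> B) (d : nat) := (elim (nn d) N (fibers t d)).2.

(** All axes of a level eliminate the same tensor t; only the guess is threaded through them. *)
Definition guess_after (t : nat -> B) (g d : nat) : nat :=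
  iteri d (fun d g => (consume (trace t d) g).2) g.

Definition guess_col (t : nat -> B) (g d : nat) : nat -> B :=
  (consume (trace t d) (guess_after t g d)).1.

Definition peel (tg : (nat -> B) * nat) : (nat -> B) * nat :=
  (fun p => tg.1 p - \prod_(d < D) guess_col tg.1 tg.2 d (idx d p), guess_after tg.1 tg.2 D).

Definition flat_cpd (t : nat -> B) (r : nat) (A : nat -> nat -> nat -> B) : Prop :=
  forall p, (p < N)%N -> t p = \sum_(s < r) \prod_(d < D) A d (idx d p) s.

Lemma fibers_cpd t r A d i p : flat_cpd t r A -> (d < D)%N -> (i < nn d)%N -> (p < N)%N ->
  fibers t d i p = \sum_(s < r) A d i s * \prod_(e < D | e != d :> nat) A e (idx e p) s.
Proof.
move=> c hd hi hp; rewrite /fibers c ?(set_idx_lt hd) //.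
apply: eq_bigr => s _; rewrite (bigD1 (Ordinal hd)) //= (idx_set_idx hd hp hi).
congr (_ * _); apply: eq_bigr => e ne.
by rewrite (idx_set_idx_ne hd hp hi).
Qed.

(* Any CPD A can be replaced by the projected A', because the eliminations send
   the tensor itself to 0; one axis after the other, X k mixes A' and A. *)
Lemma level_ex t r A : flat_cpd t r.+1 A ->
  exists t', (exists A', flat_cpd t' r A') /\
   forall g' K, (g' < q ^ (H * K))%N -> exists2 g,
     peel (t, g) = (t', g') & (g < q ^ (H * (\sum_(d < D) minn r.+1 (nn d) + K)))%N.
Proof.
move=> c.
pose A' d i s := A d i s - reduce (trace t d) (A d ^~ s) i.
pose X k d := if (d < k)%N then A' d else A d.
have hX k : (k <= D)%N -> flat_cpd t r.+1 (X k).
  elim: k => [//|k IH] hk; have {}IH := IH (ltnW hk).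
  move=> p hp; have [ei el] := elimP H0 (nn k) N (fibers t k).
  have ep := set_idx_id nn p hk; have hi := idx_lt hk hp.
  have E i : (i < nn k)%N -> fibers t k i p =
      \sum_(s < r.+1) A k i s * \prod_(e < D | e != k :> nat) X k e (idx e p) s.
    by move=> hi'; rewrite (fibers_cpd IH) // /X ltnn.
  (* The elimination sends the fiber through p to 0, so by linearity the reduced vectors contribute
     nothing and may be subtracted. *)
  have Z : \sum_(s < r.+1) reduce (trace t k) (A k ^~ s) (idx k p) *
      \prod_(e < D | e != k :> nat) X k e (idx e p) s = 0.
    rewrite -(@reduce_sum _ _ _ r.+1 (A k) (fun s => \prod_(e < D | e != k :> nat) X k e (idx e p) s)).
    rewrite -[RHS](el (idx k p) p hi hp); case: ei => al ap _ _.
    by rewrite -[RHS]/((_^~ p) _) ap; apply: reduce_ext hi => // i hi'; rewrite E.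
  rewrite -{1}ep -/(fibers t k (idx k p) p) E //.
  rewrite -[LHS]subr0 -{2}Z -sumrB.
  apply: eq_bigr => s _; rewrite -mulrBl [RHS](bigD1 (Ordinal hk)) //=.
  have -> : X k.+1 k = A' k by rewrite /X ltnSn.
  congr (_ * _); apply: eq_bigr => e ne.
  by rewrite /X [in RHS]ltnS [in RHS]leq_eqVlt (negPf ne).
have {}hX : flat_cpd t r.+1 A'.
  move=> p hp; rewrite (hX D) //; apply: eq_bigr => s _; apply: eq_bigr => d _.
  by rewrite /X ltn_ord.
(* The last term, s = r, is peeled, so that the first r columns of A' remain. *)
exists (fun p => t p - \prod_(d < D) A' d (idx d p) r); split.
  by exists A' => p hp; rewrite hX // big_ord_recr /= addrK.
have szt d : (d < D)%N -> (size (trace t d) <= minn r.+1 (nn d))%N.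
  move=> hd; have [[_ _ cnt fac] _] := elimP H0 (nn d) N (fibers t d).
  rewrite leq_min; apply/andP; split; last exact: leq_trans (leq_addr _ _) cnt.
  apply: (fac r.+1 _).1.
  exists (A d), (fun s p => \prod_(e < D | e != d :> nat) A e (idx e p) s).
  by move=> i p hi hp; rewrite (fibers_cpd c).
(* The guess is assembled from its most significant end: the digits of the last axis go below g',
   those of the earlier axes below them. *)
have ex k g' : (k <= D)%N -> exists g, [/\ guess_after t g k = g',
    (g %/ q ^ (H * \sum_(0 <= d < k) size (trace t d)) = g')%N
  & forall d i, (d < k)%N -> guess_col t g d i = A' d i r].
  elim: k g' => [|k IH] g' hk.
    by exists g'; split; rewrite // big_geq // muln0 divn1.
  have [g2 [e2 h2]] := consume_ex (trace t k) (A k ^~ r) g' (fun=> 0).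
  have [g [eg dg hg]] := IH g2 (ltnW hk).
  exists g; split.
  - by rewrite /guess_after /= -/(guess_after t g k) eg.
  - rewrite big_nat_recr //= mulnDr expnD divnMA dg -e2.
    by rewrite consume_div.
  - move=> d i; rewrite ltnS leq_eqVlt => /orP[/eqP->|]; last exact: hg.
    by rewrite /guess_col eg /consume h2 add0r.
move=> g' K hK; have [g [eg dg hg]] := ex D g' (leqnn _).
exists g.
  rewrite /peel /= eg; congr (_, _); apply: functional_extensionality => p.
  by congr (_ - _); apply: eq_bigr => d _; rewrite hg.
have le : (\sum_(0 <= d < D) size (trace t d) <= \sum_(d < D) minn r.+1 (nn d))%N.
  by rewrite big_mkord; apply: leq_sum => d _; apply: szt.
apply: (@leq_trans (q ^ (H * (\sum_(0 <= d < D) size (trace t d) + K)))).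
  by rewrite mulnDr expnD mulnC -ltn_divLR ?expn_gt0 ?cardF_gt0 // dg.
by rewrite leq_pexp2l ?cardF_gt0 // leq_mul2l leq_add2r le orbT.
Qed.

Definition budget (r : nat) : nat := (\sum_(1 <= s < r.+1) \sum_(d < D) minn s (nn d))%N.

(** The first peel uses at most the share of level r, in the lowest digits; the induction hypothesis
    bounds what is left by the budget of r - 1. *)
Lemma search_complete t r A : flat_cpd t r A ->
  exists2 g, (g < q ^ (H * budget r))%N &
    forall p, (p < N)%N -> (iter r peel (t, g)).1 p = 0.
Proof.
elim: r t A => [|r IH] t A c.
  exists 0%N; first by rewrite expn_gt0 cardF_gt0.
  by move=> p hp /=; rewrite c // big_ord0.
have [t' [[A' c'] ex]] := level_ex c.
have [g' hg' z] := IH _ _ c'; have [g eg hg] := ex g' _ hg'.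
exists g; last by move=> p hp; rewrite iterSr eg z.
by rewrite /budget big_nat_recr //= addnC.
Qed.

(** Telescoping, valid for every guess: a zero residual is all that a trial has to check. *)
Lemma search_sound t r g p : (p < N)%N ->
  t p = (iter r peel (t, g)).1 p +
    \sum_(s < r) \prod_(d < D) guess_col (iter s peel (t, g)).1 (iter s peel (t, g)).2 d (idx d p).
Proof.
move=> hp; elim: r => [|r IH]; first by rewrite big_ord0 addr0.
by rewrite big_ord_recr iterS /= {1}IH; ring.
Qed.

End Search.

(** * The program *)

Declare Scope ex_scope.
Delimit Scope ex_scope with ex.
Bind Scope ex_scope with ex.

Notation "x + y" := (EN NAdd x y) : ex_scope.
Notation "x - y" := (EN NSub x y) : ex_scope.
Notation "x * y" := (EN NMul x y) : ex_scope.
Notation "x / y" := (EN NDiv x y) : ex_scope.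
Notation "x %% y" := (EN NMod x y) : ex_scope.
Notation "x == y" := (EN NEq x y) : ex_scope.
Notation "x < y" := (EN NLt x y) : ex_scope.
Notation "$ k" := (EA k (EC 0)) (at level 2, k at level 0, format "$ k") : ex_scope.
Notation "k @[ i ]" := (EA k i%ex) (at level 8, format "k @[ i ]") : ex_scope.
Notation "'put' k i ':=' e" := (SSet k i%ex e%ex)
  (at level 70, k at level 0, i at level 0, e at level 65).
Notation "s1 ;; s2" := (SSeq s1 s2) (at level 80, right associativity).
Notation "'for' k '<' e 'do' s" := (SFor false k e%ex s)
  (at level 75, k at level 0, e at level 35, s at level 75).

(* Data arrays are named v*, loop counters w*. *)
Notation vST := 0 (only parsing).
Notation vNN := 1 (only parsing).
Notation vRR := 2 (only parsing).
Notation vG := 3 (only parsing).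
Notation vg := 4 (only parsing).
Notation vT := 5 (only parsing).
Notation vS := 6 (only parsing).
Notation vZ := 7 (only parsing).
Notation vA := 8 (only parsing).
Notation vW := 9 (only parsing).
Notation vW2 := 10 (only parsing).
Notation vY := 11 (only parsing).
Notation vOK := 12 (only parsing).
Notation vFD := 13 (only parsing).
Notation vC := 14 (only parsing).
Notation wj := 16 (only parsing).
Notation wgi := 17 (only parsing).
Notation wr := 18 (only parsing).
Notation wd := 19 (only parsing).
Notation wh := 20 (only parsing).
Notation wp1 := 21 (only parsing).
Notation wi := 22 (only parsing).
Notation wi2 := 23 (only parsing).
Notation wk := 24 (only parsing).
Notation wp2 := 25 (only parsing).
Notation wl := 26 (only parsing).
Notation wd2 := 27 (only parsing).
Notation wx := 28 (only parsing).

Definition xq := EI (EC 0).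
Definition xH := EI (EC 1).
Definition xR := EI (EC 2).
Definition xD := EI (EC 3).
Definition xn (d : ex) := EI (EC 4 + d)%ex.
Definition xN := ($vNN)%ex.

Definition xidx (d p : ex) := ((p / vST@[d]) %% xn d)%ex.
Definition xset (d p i : ex) := (p - xidx d p * vST@[d] + i * vST@[d])%ex.
Definition xa (d i r l : ex) := (((d * xN + i) * $vRR + r) * xH + l)%ex.

(** One step of a long division, applied at once to a whole row of the unfolding and to the guessed
    vector, so that the quotient is never stored. *)
Definition p_rowop : stmt :=
  for wp2 < xN do
    SIf (xidx ($wd) ($wp2) == $wi2)%ex
      (for wl < (xH - $wk) do
         put vS (($wp2 * xH + $wk) + $wl) :=
           EF FSub (vS@[($wp2 * xH + $wk) + $wl]) (EF FMul ($vC) (vZ@[$wp2 * xH + $wl])))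
      SSkip ;;
  for wl < (xH - $wk) do
    put vA (xa ($wd) ($wi2) ($wr) ($wk) + $wl) :=
      EF FAdd (vA@[xa ($wd) ($wi2) ($wr) ($wk) + $wl]) (EF FMul ($vC) (vY@[$wl])).

(** The pivot row is copied to [vZ] first, because it is itself among the rows being reduced. *)
Definition p_pivot : stmt :=
  for wl < xH do (put vY ($wl) := $vg %% xq ;; put vg (EC 0) := $vg / xq) ;;
  for wp2 < xN do for wl < xH do
    put vZ ($wp2 * xH + $wl) := vS@[xset ($wd) ($wp2) ($wi) * xH + $wl] ;;
  for wi2 < xn ($wd) do for wk < (xH - $wh) do
    (put vC (EC 0) := EF FDiv (vS@[xset ($wd) ($wp1) ($wi2) * xH + ($wh + $wk)])
                    (vZ@[$wp1 * xH + $wh]) ;;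
     p_rowop).

Definition p_axis : stmt :=
  for wx < (xN * xH) do put vS ($wx) := vT@[$wx] ;;
  for wi < xn ($wd) do for wl < xH do
    put vA (xa ($wd) ($wi) ($wr) (EC 0) + $wl) := E0 ;;
  for wh < xH do for wp1 < xN do for wi < xn ($wd) do
    SIf (vS@[xset ($wd) ($wp1) ($wi) * xH + $wh] == E0)%ex SSkip p_pivot.

Definition p_outer : stmt :=
  for wp1 < xN do
    (for wl < xH do put vW ($wl) := E0 ;;
     put vW (EC 0) := E1 ;;
     for wd2 < xD do
       (for wk < xH do
          (put vC (EC 0) := E0 ;;
           for wl < ($wk + EC 1) do
             put vC (EC 0) := EF FAdd ($vC) (EF FMul (vW@[$wl])
               (vA@[xa ($wd2) (xidx ($wd2) ($wp1)) ($wr) ($wk - $wl)])) ;;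
           put vW2 ($wk) := $vC) ;;
        for wk < xH do put vW ($wk) := vW2@[$wk]) ;;
     for wl < xH do
       put vT ($wp1 * xH + $wl) := EF FSub (vT@[$wp1 * xH + $wl]) (vW@[$wl])).

Definition p_try : stmt :=
  put vg (EC 0) := $wgi ;;
  for wx < (xN * xH) do put vT ($wx) := EI (EC 4 + xD + $wx) ;;
  for wr < ($vRR) do (for wd < xD do p_axis ;; p_outer) ;;
  put vOK (EC 0) := EC 1 ;;
  for wx < (xN * xH) do
    SIf (vT@[$wx] == E0)%ex SSkip (put vOK (EC 0) := EC 0) ;;
  put vFD (EC 0) := $vOK.

(** R may be exponential in the input size, hence the flag [true]; the columns beyond the cap are
    printed as zeros. *)
Definition p_emit : stmt :=
  for wd < xD do for wi < xn ($wd) do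
    SFor true wr xR
      (SIf ($wr < $vRR)%ex
         (for wl < xH do SEmit (vA@[xa ($wd) ($wi) ($wr) ($wl)])%ex)
         (for wl < xH do SEmit E0)).

(** The indices i < n_d with i <= r number min(r + 1, n_d), so the last loops multiply up the number
    of guesses. *)
Definition p_setup : stmt :=
  put vNN (EC 0) := EC 1 ;;
  for wj < xD do
    (put vST (xD - (EC 1 + $wj)) := $vNN ;;
     put vNN (EC 0) := $vNN * xn (xD - (EC 1 + $wj))) ;;
  SIf (xR < xN)%ex (put vRR (EC 0) := xR) (put vRR (EC 0) := xN) ;;
  put vG (EC 0) := EC 1 ;;
  for wr < ($vRR) do for wd < xD do for wi < xn ($wd) do
    SIf ($wr < $wi)%ex SSkip (for wl < xH do put vG (EC 0) := $vG * xq).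

Definition p_main : stmt :=
  p_setup ;;
  put vFD (EC 0) := EC 0 ;;
  SFor true wgi ($vG)%ex (SIf ($vFD)%ex SSkip p_try) ;;
  SIf ($vFD)%ex (SEmit (EC 1) ;; p_emit) (SEmit (EC 0)).

(* The only tensor format without axes is the scalar one, whose CPD of rank R
   is the sum of R ones; R may be exponential in the input size. *)
Definition p_scalar : stmt :=
  put vW (EC 0) := E0 ;; put vY (EC 0) := E1 ;; put vg (EC 0) := xR ;;
  SHalf wj xR
    (SIf ($vg %% EC 2)%ex (put vW (EC 0) := EF FAdd ($vW) ($vY)) SSkip ;;
     put vY (EC 0) := EF FAdd ($vY) ($vY) ;;
     put vg (EC 0) := $vg / EC 2) ;;
  put vOK (EC 0) := EC 1 ;;
  SIf (EI (EC 4) == $vW)%ex SSkip (put vOK (EC 0) := EC 0) ;;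
  for wl < (xH - EC 1) do
    SIf (EI (EC 5 + $wl) == E0)%ex SSkip (put vOK (EC 0) := EC 0) ;;
  SIf ($vOK)%ex (SEmit (EC 1)) (SEmit (EC 0)).

Definition program : stmt := SIf xD p_main p_scalar.

Lemma wf_program : wf program. Proof. by []. Qed.
(** The search and the printing follow each other, so the time is linear, not quadratic, in the
    exponential bound [GB]. *)
Lemma gdepth_program : gdepth program = 1. Proof. by []. Qed.

(** * Correctness of the program *)

Section Run.

Variables (F : finFieldType) (H D R : nat) (nn : nat -> nat).
Local Notation B := (truncpoly F H).
Local Notation q := #|F|.
Local Notation N := (sz D nn 0).
Local Notation RR := (minn R N).
Local Notation stride_of := (stride D nn).
Local Notation idx := (idx D nn).
Local Notation set_idx := (set_idx D nn).

Variables (inp : seq nat) (t0 : nat -> B) (A V M GB : nat).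

Hypothesis H0 : 0 < H.
Hypothesis inq : nth 0 inp 0 = q.
Hypothesis inH : nth 0 inp 1 = H.
Hypothesis inR : nth 0 inp 2 = R.
Hypothesis inD : nth 0 inp 3 = D.
Hypothesis inn : forall d, d < D -> nth 0 inp (4 + d) = nn d.
Hypothesis inT : forall p h, p < N -> h < H ->
  nth 0 inp (4 + D + (p * H + h)) = code (cf (t0 p) h).
Hypothesis nnN : forall d, d < D -> nn d <= N.
Hypothesis MD : D <= M.
Hypothesis MN : N * H <= M.
Hypothesis MA : M < A.
Hypothesis bA : D * N * RR * H <= A.
Hypothesis MV : M < V.
Hypothesis qV : q <= V.
Hypothesis RV : R < V.
Hypothesis GV : q ^ (H * budget D nn RR) < V.
Hypothesis GGB : q ^ (H * budget D nn RR) <= GB.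
(** The printing loop over R columns is reached only when there is an axis and every n_d is
    positive. *)
Hypothesis RGB : 0 < D -> 0 < N -> R <= GB.

Local Notation wp := (wp F inp A V M GB).
Local Notation ev := (eval_ex F inp).

Lemma wp_ifb e s1 s2 (b : bool) (Q : state -> Prop) s : ev s e = b ->
  (b -> wp s1 Q s) -> (~~ b -> wp s2 Q s) -> wp (SIf e s1 s2) Q s.
Proof.
move=> eb h1 h2; apply: wp_if; rewrite eb; first by case: (b) h1 => // h1 _; apply: h1.
by case: (b) h2 => // h2 _; apply: h2.
Qed.

(** Rule for loops filling cells b to b + n - 1 of X. When cell b + l is computed, the cells from b
    + l on still hold their old values, which covers updates in place. *)
Lemma wp_map k X ib e bnd n b (v : nat -> nat) (s : state) (Q : state -> Prop) :
  wf (SFor false k bnd (SSet X ib e)) ->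
  ev s bnd = n -> n <= M -> b + n <= A -> (forall l, l < n -> v l < V) ->
  (forall l s', l < n -> agree [:: k; X] s s' -> s' k 0 = l ->
     (forall x, x < b \/ b + l <= x -> s' X x = s X x) ->
     ev s' ib = b + l /\ ev s' e = v l) ->
  (forall s', agree [:: k; X] s s' ->
     (forall l, l < n -> s' X (b + l) = v l) ->
     (forall x, x < b \/ b + n <= x -> s' X x = s X x) -> Q s') ->
  wp (SFor false k bnd (SSet X ib e)) Q s.
Proof.
move=> w en nM nA hv hs hQ.
have kX : k != X by case/and4P: w => _; rewrite /= inE.
pose I j (s' : state) := (forall l, l < j -> s' X (b + l) = v l) /\
   (forall x, x < b \/ b + j <= x -> s' X x = s X x).
have Xk : X != k by rewrite eq_sym.
apply: (wp_for (I := I)) => //; rewrite ?en //.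
- exact: leq_ltn_trans MV.
- by move=> j s' i x; rewrite /I /= (negPf Xk).
- move=> j s' jn ag ej [h1 h2].
  have [eb ee] : ev s' ib = b + j /\ ev s' e = v j.
    by apply: hs => //; apply: agree_sub ag.
  apply: wp_set; rewrite ?eb ?ee ?hv //; first by apply: leq_trans nA; rewrite ltn_add2l.
  rewrite /I /= eqxx; split=> [l|x hx].
    rewrite ltnS leq_eqVlt eqn_add2l => /orP[/eqP->|lj]; first by rewrite eqxx.
    by rewrite ltn_eqF // h1.
  by rewrite ifN ?h2 //; lia.
- by move=> s' ag [h1 h2]; apply: hQ => //; apply: agree_sub ag.
Qed.

(** * Memory layout *)

Definition setup_done (s : state) : Prop :=
  [/\ forall d, d < D -> s vST d = stride_of d, s vNN 0 = N & s vRR 0 = RR].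

Lemma setup_done_agree ks s s' : agree ks s s' ->
  all (fun k => k \notin ks) [:: vST; vNN; vRR] -> setup_done s -> setup_done s'.
Proof. by move=> [ag _] /and3P[h0 h1 /andP[h2 _]]; rewrite /setup_done !ag. Qed.

Lemma N_leM : N <= M.
Proof. by apply: leq_trans MN; rewrite leq_pmulr. Qed.

Lemma H_leM : 0 < N -> H <= M.
Proof. by move=> n0; apply: leq_trans MN; rewrite leq_pmull. Qed.

Lemma codeV (a : F) : code a < V.
Proof. exact: leq_trans (code_lt a) qV. Qed.

Lemma cpd_addr_bound d i r : d < D -> i < nn d -> r < RR -> ((d * N + i) * RR + r).+1 * H <= A.
Proof.
move=> hd hi hr; apply: leq_trans bA; rewrite leq_mul2r; apply/orP; right.
have hiN : i < N by apply: leq_trans (nnN hd).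
apply: (@leq_trans ((d * N + i).+1 * RR)).
  by rewrite -addnS mulSnr leq_add2l.
rewrite leq_mul2r; apply/orP; right; apply: (@leq_trans (d.+1 * N)).
  by rewrite -addnS mulSnr leq_add2l.
by rewrite leq_mul2r hd orbT.
Qed.

Lemma mixed_inj m a a' b b' : b < m -> b' < m -> a * m + b = a' * m + b' ->
  a = a' /\ b = b'.
Proof.
move=> hb hb' e; have m0 : 0 < m by apply: leq_ltn_trans hb.
have ea : a = a'.
  by have := congr1 (divn^~ m) e; rewrite /= !divnMDl // !divn_small // !addn0.
by split=> //; move: e; rewrite ea => /addnI.
Qed.

Definition enc_tensor (X : nat) (s : state) (t : nat -> B) : Prop :=
  forall p h, p < N -> h < H -> s X (p * H + h) = code (cf (t p) h).

(** The unfolding has repeated columns, but each entry is stored once: entry (i, p) is found at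
    position [set_idx d p i], which is correct under [fiber_const]. *)
Definition enc_fibers (s : state) (d : nat) (W : nat -> nat -> B) : Prop :=
  forall p h, p < N -> h < H -> s vS (p * H + h) = code (cf (W (idx d p) p) h).

Definition cpd_addr (d i r h : nat) := ((d * N + i) * RR + r) * H + h.

Definition enc_col (s : state) (d r : nat) (a : nat -> B) : Prop :=
  forall i h, i < nn d -> h < H -> s vA (cpd_addr d i r h) = code (cf (a i) h).

(** A frame condition inside [vA], finer than [agree], which cannot separate two columns of one
    array. *)
Definition same_but_col (s s' : state) (d r : nat) : Prop :=
  forall d' i r' h, d' < D -> i < nn d' -> r' < RR -> h < H -> (d', r') != (d, r) ->
    s' vA (cpd_addr d' i r' h) = s vA (cpd_addr d' i r' h).

Lemma pos_lt p p' h : h < H -> p < p' -> p * H + h < p' * H.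
Proof.
move=> hh hp; apply: (@leq_trans (p.+1 * H)); last by rewrite leq_mul2r hp orbT.
by rewrite mulSn addnC ltn_add2r.
Qed.

Lemma cpd_addr_inj d i r h d' i' r' h' : d < D -> i < nn d -> r < RR -> h < H ->
  d' < D -> i' < nn d' -> r' < RR -> h' < H -> cpd_addr d i r h = cpd_addr d' i' r' h' ->
  [/\ d = d', i = i', r = r' & h = h'].
Proof.
move=> hd hi hr hh hd' hi' hr' hh' /(mixed_inj hh hh')[/(mixed_inj hr hr')[e -> ->]].
by have [-> ->] := mixed_inj (leq_trans hi (nnN hd)) (leq_trans hi' (nnN hd')) e.
Qed.

Lemma same_but_col_trans s1 s2 s3 d r : same_but_col s1 s2 d r -> same_but_col s2 s3 d r -> same_but_col s1 s3 d r.
Proof. by move=> h1 h2 d' i r' h hd hi hr hh ne; rewrite h2 // h1. Qed.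

Definition in_axis (s : state) (d r : nat) : Prop :=
  [/\ setup_done s, d < D, r < RR, s wd 0 = d & s wr 0 = r].

Lemma in_axis_agree ks s s' d r :
  agree ks s s' -> all (fun k => k \notin ks) [:: vST; vNN; vRR; wd; wr] ->
  in_axis s d r -> in_axis s' d r.
Proof.
move=> ag /and5P[h0 h1 h2 h3 /andP[h4 _]] [b hd hr ed er].
split=> //; [apply: setup_done_agree ag _ b | by rewrite ag.1 | by rewrite ag.1].
by rewrite /= h0 h1 h2.
Qed.

Lemma rowop_ok s d r i2 k (cc : F) (W : nat -> nat -> B) (z : nat -> B) (a : nat -> B) (y : B) :
  in_axis s d r -> s wi2 0 = i2 -> i2 < nn d -> s wk 0 = k -> k < H ->
  s vC 0 = code cc ->
  enc_fibers s d W -> enc_tensor vZ s z -> enc_col s d r a ->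
  (forall l, l < H -> s vY l = code (cf y l)) ->
  wp p_rowop (fun s' =>
    [/\ enc_fibers s' d (fun i p => if i == i2 then (W i p - mono _ k cc * z p)%R else W i p),
        enc_col s' d r (fun i => if i == i2 then (a i + mono _ k cc * y)%R else a i)
      & same_but_col s s' d r]) s.
Proof.
move=> cx e2 h2 ek hk ec eS eZ eA eY.
have [bs hd hr ed er] := cx; have [b1 b2 b3] := bs.
apply: wp_seq.
pose I j s' := forall p h, p < N -> h < H ->
  s' vS (p * H + h) =
  code (cf (if (p < j) && (idx d p == i2) then (W (idx d p) p - mono _ k cc * z p)%R
            else W (idx d p) p) h).
apply: (wp_for (I := I)) => //=.
- by rewrite b2; apply: leq_ltn_trans N_leM MV.
- by rewrite b2 N_leM.
- move=> p s' hp ag ep hI; rewrite b2 in hp.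
  have N0 : 0 < N by apply: leq_ltn_trans hp.
  have [[c1 c2 c3] _ _ d1 r1] := in_axis_agree ag isT cx.
  (* Throughout, [ag.1 k isT] says that array k is unchanged; [isT] checks by computation that k is
     not among the modified arrays. *)
  have sC := ag.1 14 isT; have sZ := ag.1 7 isT.
  have eidx : ev s' (xidx (EA wd (EC 0)) (EA wp2 (EC 0))) = idx d p.
    by rewrite /= d1 ep c1 // inn.
  have sk : s' wk 0 = k by rewrite (ag.1 24 isT).
  have si2 : s' wi2 0 = i2 by rewrite (ag.1 23 isT).
  have ecnd : ev s' (xidx (EA wd (EC 0)) (EA wp2 (EC 0)) == EA wi2 (EC 0))%ex = (idx d p == i2).
    by rewrite -eidx -si2.
  apply: wp_ifb ecnd _ _ => [/eqP ei|nei].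
    apply: (wp_map (n := H - k) (b := p * H + k)
      (v := fun l => code (cf (W (idx d p) p - mono _ k cc * z p)%R (k + l)))) => //=.
    + by rewrite inH sk.
    + by apply: leq_trans (leq_subr _ _) (H_leM N0).
    + apply: (@leq_trans (N * H)); last exact: leq_trans MN (ltnW MA).
      rewrite -addnA subnKC; last exact: ltnW.
      by rewrite -mulSnr leq_mul2r hp orbT.
    + by move=> l hl; apply: codeV.
    + move=> l s2 hl ag2 el hx.
      have lH : k + l < H by rewrite -ltn_subRL.
      rewrite (ag2.1 25 isT) (ag2.1 24 isT) (ag2.1 14 isT) (ag2.1 7 isT).
      rewrite el ep sk inH; split=> //.
      rewrite hx; last by right.
      rewrite -!addnA hI // ltnn /= sC sZ ec eZ //; last first.
        by apply: leq_ltn_trans lH; apply: leq_addl.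
      by rewrite !codeK cfB cf_monoM // leq_addr addKn.
    + move=> s2 ag2 hv hx p' h hp' hh.
      have [epp|nep] := eqVneq p' p.
        rewrite epp ei eqxx ltnSn /=; have [kh|hk'] := leqP k h.
          by have := hv (h - k); rewrite -addnA subnKC // ei => ->; rewrite // ltn_sub2r.
        rewrite hx; last by left; rewrite ltn_add2l.
        rewrite hI // ltnn /= cfB cf_monoM // [k <= h]leqNgt hk' /= subr0.
        by rewrite ei.
      rewrite hx.
        by rewrite hI // ltnS [p' <= p]leq_eqVlt (negPf nep).
      case: (ltngtP p' p) nep => // lpp _.
        left; apply: leq_trans (pos_lt hh lpp) _; exact: leq_addr.
      right; rewrite -addnA subnKC; last exact: ltnW.
      rewrite -mulSnr; apply: leq_trans (leq_addr _ _); rewrite leq_mul2r lpp orbT //.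
  apply: wp_skip => p' h hp' hh; rewrite hI // ltnS [p' <= p]leq_eqVlt.
  by have [->|//] := eqVneq p' p; rewrite (negPf nei) andbF.
- move=> s1 ag hI; rewrite b2 in hI.
  have cx1 := in_axis_agree ag isT cx; have [[c1 c2 c3] _ _ d1 r1] := cx1.
  case: (posnP N) => [N0|N0]; first by move: (nnN hd); rewrite N0 leqn0 => /eqP e0; rewrite e0 in h2.
  have eA1 : enc_col s1 d r a by move=> i h hi hh; rewrite (ag.1 8 isT) eA.
  apply: (wp_map (n := H - k) (b := cpd_addr d i2 r k)
      (v := fun l => code (cf (a i2 + mono _ k cc * y)%R (k + l)))) => //=.
  + by rewrite inH (ag.1 24 isT) ek.
  + by apply: leq_trans (leq_subr _ _) (H_leM N0).
  + by rewrite /cpd_addr -addnA subnKC ?(ltnW hk) // -mulSnr; apply: cpd_addr_bound.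
  + by move=> l hl; apply: codeV.
  + move=> l s2 hl ag2 el hx.
    have lH : k + l < H by rewrite -ltn_subRL.
    rewrite (ag2.1 19 isT) (ag2.1 1 isT) (ag2.1 23 isT) (ag2.1 2 isT) (ag2.1 18 isT).
    rewrite (ag2.1 24 isT) (ag2.1 14 isT) (ag2.1 11 isT) el d1 c2 c3 r1 inH.
    rewrite (ag.1 23 isT) (ag.1 24 isT) (ag.1 14 isT) (ag.1 11 isT) e2 ek ec -/(cpd_addr _ _ _ _).
    split=> //; rewrite hx; last by right.
    rewrite /cpd_addr -addnA -/(cpd_addr _ _ _ _) eA1 // eY; last first.
      by apply: leq_ltn_trans lH; apply: leq_addl.
    by rewrite !codeK cfD cf_monoM // leq_addr addKn.
  + move=> s2 ag2 hv hx.
    have hx' d' i' r' h' : d' < D -> i' < nn d' -> r' < RR -> h' < H ->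
        (d', i', r') != (d, i2, r) \/ h' < k -> s2 8 (cpd_addr d' i' r' h') = s1 8 (cpd_addr d' i' r' h').
      move=> hd' hi' hr' hh' ne; apply: hx.
      have [lt|ge] := ltnP (cpd_addr d' i' r' h') (cpd_addr d i2 r k); first by left.
      right; rewrite leqNgt; apply/negP => lt.
      (* An address inside the updated block is that of a coefficient of entry (d, i2, r), so
         injectivity of addresses identifies the two. *)
      pose h2' := cpd_addr d' i' r' h' - cpd_addr d i2 r k + k.
      have hh2 : h2' < H by rewrite /h2'; lia.
      have e : cpd_addr d' i' r' h' = cpd_addr d i2 r h2' by rewrite /h2' /cpd_addr in ge lt *; lia.
      have [ed' ei' er' eh'] := cpd_addr_inj hd' hi' hr' hh' hd h2 hr hh2 e.
      by case: ne => [|hk']; [rewrite ed' ei' er' eqxx | rewrite eh' /h2' in hk'; lia].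
    split.
    * move=> p h hp hh; rewrite (ag2.1 6 isT) hI // hp /=.
      by case: eqP.
    * move=> i h hi hh; have [ei|nei] := eqVneq i i2; last first.
        by rewrite hx' ?eA1 //; left; rewrite !xpair_eqE (negPf nei) andbF.
      rewrite ei; have [kh|hk'] := leqP k h.
        by have := hv (h - k); rewrite /cpd_addr -addnA subnKC // => ->; rewrite // ltn_sub2r.
      rewrite hx' //; last by right.
      by rewrite eA1 // cfD cf_monoM // [k <= h]leqNgt hk' /= addr0.
    * move=> d' i' r' h' hd' hi' hr' hh' ne; rewrite hx' ?(ag.1 8 isT) //; left.
      by apply: contra ne => /eqP[-> _ ->].
Qed.

Lemma enc_fibers_ext s d W W' :
  (forall p, p < N -> W (idx d p) p = W' (idx d p) p) -> enc_fibers s d W -> enc_fibers s d W'.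
Proof. by move=> e h p j hp hj; rewrite h // e. Qed.

Lemma enc_col_ext s d r a a' :
  (forall i, i < nn d -> a i = a' i) -> enc_col s d r a -> enc_col s d r a'.
Proof. by move=> e h i j hi hj; rewrite h // e. Qed.

Lemma fold_idx d p : p %/ stride_of d %% nn d = idx d p. Proof. by []. Qed.
Lemma fold_setp d p i : p - idx d p * stride_of d + i * stride_of d = set_idx d p i. Proof. by []. Qed.

Lemma read_ok (s : state) g (Q : state -> Prop) : 0 < N -> s vg 0 = g -> g < V ->
  (forall s', agree [:: wl; vY; vg] s s' ->
     (forall l, l < H -> s' vY l = code (cf (guess_elt F H g) l)) ->
     s' vg 0 = g %/ q ^ H -> Q s') ->
  wp (for wl < xH do (put vY ($ wl)%ex := $ vg %% xq ;; put vg (EC 0) := $ vg / xq)) Q s.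
Proof.
move=> N0 eg gV hQ; have H_leM := H_leM N0.
pose I j (s' : state) := j <= H -> s' vg 0 = g %/ q ^ j /\
  forall l, l < j -> s' vY l = code (cf (guess_elt F H g) l).
apply: (wp_for (I := I)) => //=; rewrite ?inH //.
- exact: leq_ltn_trans MV.
- by move=> _; rewrite eg divn1.
- move=> j s' hj ag ej /(_ (ltnW hj))[h1 h2].
  apply: wp_seq; apply: wp_set => /=.
  + by rewrite ej; apply: ltn_trans hj (leq_ltn_trans H_leM MA).
  + by rewrite inq; apply: leq_trans qV; rewrite ltn_mod cardF_gt0.
  apply: wp_set => /=; first exact: leq_ltn_trans MA.
    by rewrite h1 inq; do 2!(apply: leq_ltn_trans (leq_div _ _) _).
  move=> _; split=> /=; first by rewrite h1 inq -divnMA -expnSr.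
  move=> l; rewrite ej ltnS leq_eqVlt => /orP[/eqP->|lj]; last by rewrite ltn_eqF // h2.
  by rewrite eqxx h1 inq cf_mk // decodeK // ltn_mod cardF_gt0.
- by move=> s' ag /(_ (leqnn _))[h1 h2]; apply: hQ => //; apply: agree_sub ag => k.
Qed.

Definition fiber_const (d : nat) (W : nat -> nat -> B) : Prop :=
  forall i p j, i < nn d -> p < N -> j < nn d -> W i (set_idx d p j) = W i p.

Lemma pivot_ok s d r h p i W a g :
  in_axis s d r -> s wh 0 = h -> h < H -> s wp1 0 = p -> p < N -> s wi 0 = i -> i < nn d ->
  enc_fibers s d W -> fiber_const d W -> enc_col s d r a -> s vg 0 = g -> g < V ->
  let w i' := quo h (W i' p) (W i p) in
  wp p_pivot (fun s' =>
    [/\ enc_fibers s' d (fun i' p' => W i' p' - w i' * W i p')%R,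
        enc_col s' d r (fun i' => a i' + w i' * guess_elt F H g)%R,
        s' vg 0 = g %/ q ^ H & same_but_col s s' d r]) s.
Proof.
move=> cx eh hh ep hp ei hi eS fW eC eg gV w.
have N0 : 0 < N by apply: leq_ltn_trans hp.
have [_ hd hr _ _] := cx.
have H_leM := H_leM N0.
apply: wp_seq; apply: read_ok eg gV _ => // s1 ag1 hY hg.
have cx1 := in_axis_agree ag1 isT cx.
apply: wp_seq.
pose I j (s' : state) := forall p2 l, p2 < j -> l < H ->
  s' vZ (p2 * H + l) = code (cf (W i p2) l).
apply: (wp_for (I := I)) => //=.
- by have [[_ -> _] _ _ _ _] := cx1; apply: leq_ltn_trans N_leM MV.
- by have [[_ -> _] _ _ _ _] := cx1; apply: N_leM.
- move=> p2 s2 hp2 ag2 ep2 hI.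
  have cx2 := in_axis_agree ag2 isT cx1; have [[c1 c2 c3] _ _ d1 r1] := cx2.
  have {}hp2 : p2 < N by have [[_ e _] _ _ _ _] := cx1; rewrite e in hp2.
  apply: (wp_map (n := H) (b := p2 * H) (v := fun l => code (cf (W i p2) l))) => //=.
  + apply: (@leq_trans (N * H)); last exact: leq_trans MN (ltnW MA).
    by rewrite -mulSnr leq_mul2r hp2 orbT.
  + by move=> l hl; apply: codeV.
  + move=> l s3 hl ag3 el hx.
    rewrite (ag3.1 25 isT) (ag3.1 0 isT) (ag3.1 19 isT) (ag3.1 22 isT) (ag3.1 6 isT).
    rewrite (ag2.1 22 isT) (ag1.1 22 isT) (ag2.1 6 isT) (ag1.1 6 isT).
    rewrite el ep2 d1 ei c1 // inn // inH fold_idx fold_setp; split=> //.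
    by rewrite eS ?(set_idx_lt hd) // (idx_set_idx hd) // fW.
  + move=> s3 ag3 hv hx p3 l; rewrite ltnS leq_eqVlt => /orP[/eqP->|hp3] hl.
      by rewrite hv.
    by rewrite hx ?hI //; left; apply: pos_lt.
move=> s2 ag2; have [[_ eN _] _ _ _ _] := cx1; rewrite eN /I {I} => hZ.
have cx2 := in_axis_agree ag2 isT cx1.
have [[_ _ _] _ _ ed2 _] := cx2.
have eS2 : enc_fibers s2 d W by move=> p' j hp' hj; rewrite (ag2.1 6 isT) (ag1.1 6 isT) eS.
have eC2 : enc_col s2 d r a by move=> i' j hi' hj; rewrite (ag2.1 8 isT) (ag1.1 8 isT) eC.
have {}hY l : l < H -> s2 vY l = code (cf (guess_elt F H g) l).
  by move=> hl; rewrite (ag2.1 11 isT) hY.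
have {}hg : s2 vg 0 = g %/ q ^ H by rewrite (ag2.1 4 isT).
have sA2 : same_but_col s s2 d r by move=> *; rewrite (ag2.1 8 isT) (ag1.1 8 isT).
pose y := guess_elt F H g.
pose J j (s' : state) := [/\
   enc_fibers s' d (fun i' p' => if (i' < j)%N then W i' p' - w i' * W i p' else W i' p')%R,
   enc_col s' d r (fun i' => if (i' < j)%N then a i' + w i' * y else a i')%R
   & same_but_col s s' d r].
have eb2 : nth 0 inp (4 + s2 19 0) = nn d by rewrite ed2 inn.
apply: (wp_for (I := J)) => //=; rewrite ?eb2.
- by apply: leq_ltn_trans (leq_trans (nnN hd) N_leM) MV.
- exact: leq_trans (nnN hd) N_leM.
- move=> i2 s3 hi2 ag3 ei2 [hJ1 hJ2 hJ3].
  have cx3 := in_axis_agree ag3 isT cx2.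
  (* The division of entry (i2, p) by the pivot after k steps; its remainder is the current entry
     (i2, p) itself. *)
  pose sw k := iteri k (quo_step h (W i p)) (W i2 p, 0%R).
  pose K k (s' : state) := [/\
    enc_fibers s' d (fun i' p' => if (i' < i2)%N then W i' p' - w i' * W i p'
       else if i' == i2 then W i' p' - (sw k).2 * W i p' else W i' p')%R,
    enc_col s' d r (fun i' => if (i' < i2)%N then a i' + w i' * y
       else if i' == i2 then a i' + (sw k).2 * y else a i')%R
    & same_but_col s s' d r].
  have eh3 : s3 20 0 = h by rewrite (ag3.1 20 isT) (ag2.1 20 isT) (ag1.1 20 isT).
  apply: (wp_for (I := K)) => //=; rewrite ?inH ?eh3.
  + exact: leq_ltn_trans (leq_subr _ _) (leq_ltn_trans H_leM MV).
  + exact: leq_trans (leq_subr _ _) H_leM.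
  + split=> //.
      apply: enc_fibers_ext hJ1 => p' hp' /=; case: ifP => // _.
      by case: eqP => // _; rewrite mul0r subr0.
    apply: enc_col_ext hJ2 => i' hi' /=; case: ifP => // _.
    by case: eqP => // _; rewrite mul0r addr0.
  + move=> k s4 hk ag4 ek [hK1 hK2 hK3].
    have cx4 := in_axis_agree ag4 isT cx3; have [[c1 c2 c3] _ _ d1 r1] := cx4.
    have hkH : h + k < H by rewrite -ltn_subRL.
    apply: wp_seq; apply: wp_set => /=; [exact: leq_ltn_trans MA | exact: codeV|].
    set cc := (X in code X).
    have ecc : cc = (cf (sw k).1 (h + k) / cf (W i p) h)%R.
      rewrite /cc /= (ag4.1 7 isT) (ag3.1 7 isT) (ag4.1 21 isT) (ag3.1 21 isT).
      rewrite (ag2.1 21 isT) (ag1.1 21 isT) ep (ag4.1 20 isT) eh3 inH hZ // codeK.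
      congr (_ / _)%R; rewrite (ag4.1 23 isT) ei2 ek d1 c1 // inn // fold_idx fold_setp.
      rewrite hK1 ?(set_idx_lt hd) // (idx_set_idx hd) // ltnn eqxx codeK !fW //.
      by rewrite quo_sub.
    apply: (wp_post _ (rowop_ok (s := upd s4 14 0 (code cc)) (r := r) (d := d) (i2 := i2) (k := k) (cc := cc)
        (z := W i) (y := y) _ _ _ _ _ _ hK1 _ hK2 _)) => //=.
    * by rewrite (ag4.1 23 isT).
    * exact: leq_ltn_trans (leq_addl _ _) hkH.
    * by move=> p' l hp' hl /=; rewrite (ag4.1 7 isT) (ag3.1 7 isT) hZ.
    * by move=> l hl; rewrite (ag4.1 11 isT) (ag3.1 11 isT) hY.
    * have esw : (sw k.+1).2 = ((sw k).2 + mono H k cc)%R.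
        by rewrite /sw iteriS -/(sw k) /quo_step /= ecc.
      move=> s5 ag5 [h1 h2 h3]; split.
      - apply: enc_fibers_ext h1 => p' hp'; rewrite esw /=; case: eqP => [->|//].
        by rewrite ltnn mulrDl opprD addrA.
      - apply: enc_col_ext h2 => i' hi'; rewrite esw /=; case: eqP => [->|//].
        by rewrite ltnn mulrDl addrA.
      - exact: same_but_col_trans hK3 h3.
  + move=> s4 ag4 [hK1 hK2 hK3]; split=> //.
    * apply: enc_fibers_ext hK1 => p' hp' /=; rewrite [in RHS]ltnS [in RHS]leq_eqVlt.
      by case: eqP => [->|_] /=; [rewrite ltnn | case: ifP].
    * apply: enc_col_ext hK2 => i' hi' /=; rewrite [in RHS]ltnS [in RHS]leq_eqVlt.
      by case: eqP => [->|_] /=; [rewrite ltnn | case: ifP].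
- move=> s3 ag3 [h1 h2 h3]; split=> //.
  + by apply: enc_fibers_ext h1 => p' hp'; rewrite idx_lt.
  + by apply: enc_col_ext h2 => i' ->.
  + by rewrite (ag3.1 4 isT).
Qed.

Lemma fibers_const t d : d < D -> fiber_const d (fibers D nn t d).
Proof. by move=> hd i p j hi hp hj; rewrite /fibers (set_idx_set_idx hd). Qed.

Lemma axis_ok s d r (t : nat -> B) g :
  in_axis s d r -> enc_tensor vT s t -> s vg 0 = g -> g < V ->
  wp p_axis (fun s' =>
    [/\ enc_col s' d r (consume (trace D nn t d) g).1,
        s' vg 0 = (consume (trace D nn t d) g).2 & same_but_col s s' d r]) s.
Proof.
move=> cx eT eg gV; have [bs hd hr _ _] := cx; have [_ bN bR] := bs.
apply: wp_seq; apply: (wp_map (n := N * H) (b := 0) (v := fun x => s vT x)) => //=.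
- by rewrite bN inH.
- by apply: leq_trans MN (ltnW MA).
- move=> x hx; case: (posnP H) => [e|h0]; first by rewrite e muln0 in hx.
  rewrite (divn_eq x H) eT ?codeV ?ltn_mod //.
  by rewrite ltn_divLR.
- by move=> l s' hl ag el hx; rewrite (ag.1 5 isT) el.
move=> s1 ag1 eS _.
have cx1 := in_axis_agree ag1 isT cx; have [[b1 b2 b3] _ _ d1 r1] := cx1.
have eb1 : nth 0 inp (4 + s1 19 0) = nn d by rewrite d1 inn.
apply: wp_seq.
pose I j (s' : state) := (forall i h, i < j -> i < nn d -> h < H ->
   s' vA (cpd_addr d i r h) = code (0%R : F)) /\ same_but_col s s' d r.
apply: (wp_for (I := I)) => //=; rewrite ?eb1.
- by apply: leq_ltn_trans (leq_trans (nnN hd) N_leM) MV.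
- exact: leq_trans (nnN hd) N_leM.
- by split=> [i h //|d' i' r' h' *]; rewrite (ag1.1 8 isT).
- move=> i s2 hi ag2 ei [hI1 hI2].
  have N0 : 0 < N by apply: leq_trans (nnN hd); apply: leq_ltn_trans hi.
  have cx2 := in_axis_agree ag2 isT cx1; have [[c1 c2 c3] _ _ d2 r2] := cx2.
  apply: (wp_map (n := H) (b := cpd_addr d i r 0) (v := fun=> code (0%R : F))) => //=.
  + exact: H_leM.
  + by rewrite /cpd_addr addn0 -mulSnr; apply: cpd_addr_bound.
  + by move=> l hl; apply: codeV.
  + move=> l s3 hl ag3 el hx; split=> //.
    rewrite (ag3.1 19 isT) (ag3.1 1 isT) (ag3.1 22 isT) (ag3.1 2 isT) (ag3.1 18 isT).
    by rewrite el d2 c2 ei c3 r2 inH.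
  + move=> s3 ag3 hv hx.
    have out d' i' r' h' : d' < D -> i' < nn d' -> r' < RR -> h' < H ->
        (d', i', r') != (d, i, r) -> s3 8 (cpd_addr d' i' r' h') = s2 8 (cpd_addr d' i' r' h').
      move=> hd' hi' hr' hh' ne; apply: hx.
      have [lt|ge] := ltnP (cpd_addr d' i' r' h') (cpd_addr d i r 0); first by left.
      right; rewrite leqNgt; apply/negP => lt.
      pose h2' := cpd_addr d' i' r' h' - cpd_addr d i r 0.
      have hh2 : h2' < H by rewrite /h2'; lia.
      have e : cpd_addr d' i' r' h' = cpd_addr d i r h2' by rewrite /h2' /cpd_addr in ge lt *; lia.
      have [ed' ei' er' eh'] := cpd_addr_inj hd' hi' hr' hh' hd hi hr hh2 e.
      by rewrite ed' ei' er' eqxx in ne.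
    split.
      move=> i' h; rewrite ltnS leq_eqVlt => /orP[/eqP->|lt] hi' hh.
        by have := hv h hh; rewrite /cpd_addr addn0.
      by rewrite out ?hI1 //; apply/eqP => -[e]; rewrite e ltnn in lt.
    move=> d' i' r' h' hd' hi' hr' hh' ne; rewrite out ?hI2 //.
    by apply: contra ne => /eqP[-> _ ->].
move=> s2 ag2 [hC2 hA2].
have cx2 := in_axis_agree ag2 isT cx1; have [[c1 c2 c3] _ _ d2 r2] := cx2.
have eb2 : nth 0 inp (4 + s2 19 0) = nn d by rewrite d2 inn.
have eg2 : s2 4 0 = g by rewrite (ag2.1 4 isT) (ag1.1 4 isT).
have [N0|N0] := posnP N.
  have nd0 : nn d = 0 by apply/eqP; rewrite -leqn0 -N0; apply: nnN.
  by move: hr; rewrite N0 minn0.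
have H_leM := H_leM N0.
(* The trace x.2 is a ghost: memory holds the matrix x.1, while each pivot is consumed as soon as it
   is found. *)
pose K (x : elim_state F H) (s' : state) := [/\ enc_fibers s' d x.1, fiber_const d x.1,
   enc_col s' d r (consume x.2 g).1, s' vg 0 = (consume x.2 g).2 & same_but_col s s' d r].
pose x0 : elim_state F H := (fibers D nn t d, [::]).
have K0 : K x0 s2.
  split=> //=.
  - move=> p h hp hh; rewrite (ag2.1 6 isT) -[p * H + h]add0n eS ?add0n; last exact: pos_lt.
    by rewrite eT // /fibers set_idx_id.
  - exact: fibers_const.
  - by move=> i h hi hh; rewrite hC2 // cf0.
pose L1 h := iteri h (elim_val (nn d) N) x0.
apply: (wp_for (I := fun h => K (L1 h))) => //=; rewrite ?inH.
- exact: leq_ltn_trans H_leM MV.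
- exact: H_leM.
- move=> h s3 hh ag3 eh hK3.
  have cx3 := in_axis_agree ag3 isT cx2.
  have bN3 : s3 1 0 = N by have [[_ -> _] _ _ _ _] := cx3.
  pose L2 p := iteri p (elim_fiber (nn d) h) (L1 h).
  apply: (wp_for (I := fun p => K (L2 p))) => //=; rewrite ?bN3.
  + exact: leq_ltn_trans N_leM MV.
  + exact: N_leM.
  + move=> p s4 hp ag4 ep hK4.
    have cx4 := in_axis_agree ag4 isT cx3; have [[f1 f2 f3] _ _ d4 r4] := cx4.
    have eb4 : nth 0 inp (4 + s4 19 0) = nn d by rewrite d4 inn.
    pose L3 i := iteri i (elim_step h p) (L2 p).
    apply: (wp_for (I := fun i => K (L3 i))) => //=; rewrite ?eb4.
    * by apply: leq_ltn_trans (leq_trans (nnN hd) N_leM) MV.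
    * exact: leq_trans (nnN hd) N_leM.
    move=> i s5 hi ag5 ei hK5.
    have cx5 := in_axis_agree ag5 isT cx4; have [[h1 h2 h3] _ _ d5 r5] := cx5.
    have [k1 k2 k3 k4 k5] := hK5.
    have eh5 : s5 20 0 = h by rewrite (ag5.1 20 isT) (ag4.1 20 isT).
    have ep5 : s5 21 0 = p by rewrite (ag5.1 21 isT).
    have ebr : ev s5 (vS@[xset ($ wd) ($ wp1) ($ wi) * xH + $ wh] == E0)%ex
        = (cf ((L3 i).1 i p) h == 0%R).
      rewrite /= ep5 ei eh5 d5 h1 // inn // inH fold_idx fold_setp.
      rewrite k1 ?(set_idx_lt hd) // (idx_set_idx hd) // k2 //.
      by rewrite (inj_eq (can_inj (@codeK F))).
    apply: wp_ifb ebr _ _ => [z|nz].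
      by apply: wp_skip; rewrite /elim_step z.
    apply: (wp_post _ (pivot_ok (s := s5) (i := i) (p := p) (h := h) cx5 _ _ _ _ _ _ k1 k2 k3 k4 _)) => //.
      by rewrite /consume consume_div /=; apply: leq_ltn_trans (leq_div _ _) gV.
    move=> s6 ag6 [e1 e2 e3 e4].
    rewrite /elim_step (negPf nz) /K; split=> //=.
    * move=> i' p' j hi' hp' hj; rewrite !k2 //.
    * by rewrite /consume foldl_rcons -/(consume _ _).
    * by rewrite /consume foldl_rcons -/(consume _ _) e3.
    * exact: same_but_col_trans k5 e4.
  + by [].
- by [].
- by move=> s3 ag3 [k1 k2 k3 k4 k5]; split.
Qed.

Definition in_level (s : state) (r : nat) : Prop := [/\ setup_done s, r < RR & s wr 0 = r].

Lemma in_level_agree ks s s' r : agree ks s s' ->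
  all (fun k => k \notin ks) [:: vST; vNN; vRR; wr] -> in_level s r -> in_level s' r.
Proof.
move=> ag /and4P[h0 h1 h2 /andP[h4 _]] [b hr er].
split=> //; [apply: setup_done_agree ag _ b | by rewrite ag.1].
by rewrite /= h0 h1 h2.
Qed.

Lemma outer_ok s r (t : nat -> B) (a : nat -> nat -> B) :
  in_level s r -> enc_tensor vT s t -> (forall d, d < D -> enc_col s d r (a d)) ->
  wp p_outer (fun s' => enc_tensor vT s' (fun p => t p - \prod_(d < D) a d (idx d p))%R) s.
Proof.
move=> cx eT eC; have [bs hr _] := cx; have [_ bN bR] := bs.
have N0 : 0 < N by case: (posnP N) => // N0; move: hr; rewrite N0 minn0.
have H_leM := H_leM N0.
pose prd n p := (\prod_(d < n) a d (idx d p))%R.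
pose I j (s' : state) := enc_tensor vT s' (fun p => if (p < j)%N then t p - prd D p else t p)%R.
apply: (wp_for (I := I)) => //=; rewrite ?bN.
- exact: leq_ltn_trans N_leM MV.
- exact: N_leM.
- move=> p s1 hp ag1 ep hI.
  have cx1 := in_level_agree ag1 isT cx; have [[b1 b2 b3] _ r1] := cx1.
  have eC1 d : d < D -> enc_col s1 d r (a d) by move=> hd i h hi hh; rewrite (ag1.1 8 isT) eC.
  apply: wp_seq; apply: (wp_map (n := H) (b := 0) (v := fun=> code (0%R : F))) => //=.
  + exact: leq_trans H_leM (ltnW MA).
  + by move=> l hl; apply: codeV.
  move=> s2 ag2 hv _; apply: wp_seq; apply: wp_set => /=.
  + exact: leq_ltn_trans MA.
  + exact: codeV.
  apply: wp_seq.
  set s3 := upd _ _ _ _.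
  have ag3 : agree [:: 26; 9] s1 s3.
    by apply: agree_trans ag2 _; apply: agree_upd.
  pose J d (s' : state) := forall l, l < H -> s' vW l = code (cf (prd d p) l).
  apply: (wp_for (I := J)) => //=; rewrite ?inD.
  + exact: leq_ltn_trans MD MV.
  + exact: MD.
  + move=> l hl; rewrite /prd big_ord0 cf1 /s3 /=.
    by case: eqP => // _; rewrite -(hv l hl) add0n.
  + move=> d s4 hd ag4 ed hJ.
    have cx4 : in_level s4 r.
      by apply: in_level_agree ag4 isT _; apply: in_level_agree ag2 isT cx1.
    have [[c1 c2 c3] _ r4] := cx4.
    have eC4 : enc_col s4 d r (a d).
      by move=> i h hi hh; rewrite (ag4.1 8 isT) /= (ag2.1 8 isT) eC1.
    have ep4 : s4 21 0 = p by rewrite (ag4.1 21 isT) /= (ag2.1 21 isT).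
    have hi := idx_lt hd hp.
    apply: wp_seq.
    pose K k (s' : state) := forall l, l < k -> s' vW2 l = code (cf (prd d.+1 p) l).
    apply: (wp_for (I := K)) => //=; rewrite ?inH.
    * exact: leq_ltn_trans H_leM MV.
    * exact: H_leM.
    * move=> k s5 hk ag5 ek hK.
      have [[d1 d2 d3] _ r5] := in_level_agree ag5 isT cx4.
      apply: wp_seq; apply: wp_set => /=; [exact: leq_ltn_trans MA | exact: codeV|].
      apply: wp_seq.
      set s6 := upd _ _ _ _.
      pose S j (s' : state) := s' vC 0 = code
        (\sum_(l < j) cf (prd d p) l * cf (a d (idx d p)) (k - l))%R.
      apply: (wp_for (I := S)) => //=; rewrite ?ek ?addn1.
      - exact: leq_ltn_trans hk (leq_ltn_trans H_leM MV).
      - exact: leq_trans hk H_leM.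
      - by rewrite /S big_ord0.
      - move=> l s7 hl ag7 el hS.
        apply: wp_set => /=; [exact: leq_ltn_trans MA | exact: codeV|].
        rewrite /S /= big_ord_recr /= hS; congr code.
        have lk : l <= k by [].
        rewrite codeK; congr (_ + _)%R.
        rewrite (ag7.1 9 isT) (ag7.1 27 isT) (ag7.1 1 isT) (ag7.1 21 isT) (ag7.1 0 isT).
        rewrite (ag7.1 2 isT) (ag7.1 18 isT) (ag7.1 24 isT) (ag7.1 8 isT) el /=.
        rewrite (ag5.1 9 isT) (ag5.1 27 isT) (ag5.1 21 isT) (ag5.1 8 isT).
        rewrite ed d2 ep4 d1 // inn // d3 r5 ek inH fold_idx hJ; last exact: leq_ltn_trans hk.
        rewrite codeK -/(cpd_addr _ _ _ _) eC4 // ?codeK //.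
        exact: leq_ltn_trans (leq_subr _ _) hk.
      - move=> s7 ag7 hS; apply: wp_set => /=.
        + by rewrite (ag7.1 24 isT) /= ek; apply: ltn_trans hk (leq_ltn_trans H_leM MA).
        + by rewrite hS; apply: codeV.
        rewrite (ag7.1 24 isT) /= ek hS => l; rewrite ltnS leq_eqVlt.
        case/orP=> [/eqP->|lk] /=; last by rewrite ltn_eqF // (ag7.1 10 isT) /= hK.
        by rewrite eqxx /prd [in RHS]big_ord_recr /= cfM.
    * move=> s5 ag5 hK.
      apply: (wp_map (n := H) (b := 0) (v := fun l => code (cf (prd d.+1 p) l))) => //=.
      - exact: leq_trans H_leM (ltnW MA).
      - by move=> l hl; apply: codeV.
      - by move=> l s6 hl ag6 el hx; rewrite el (ag6.1 10 isT) hK.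
  + move=> s4 ag4 hJ.
    have cx4 : in_level s4 r.
      by apply: in_level_agree ag4 isT _; apply: in_level_agree ag2 isT cx1.
    have ep4 : s4 21 0 = p by rewrite (ag4.1 21 isT) /= (ag2.1 21 isT).
    have eT4 : s4 5 = s1 5 by rewrite (ag4.1 5 isT) /= (ag2.1 5 isT).
    apply: (wp_map (n := H) (b := p * H)
      (v := fun l => code (cf (t p - prd D p)%R l))) => //=.
    * by rewrite -mulSnr; apply: leq_trans (leq_mul hp (leqnn H)) (leq_trans MN (ltnW MA)).
    * by move=> l hl; apply: codeV.
    * move=> l s5 hl ag5 el hx; rewrite (ag5.1 21 isT) (ag5.1 9 isT) el ep4 inH; split=> //.
      rewrite hx; last by right.
      by rewrite eT4 hI // ltnn hJ // !codeK cfB.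
    * move=> s5 ag5 hw hx p' l hp' hl; rewrite ltnS leq_eqVlt.
      have [->|nep] /= := eqVneq p' p; first by rewrite hw.
      rewrite hx ?eT4 ?hI //.
      case: (ltngtP p' p) nep => // lpp _; first by left; apply: pos_lt.
      by right; rewrite -mulSnr; apply: leq_trans (leq_addr _ _); rewrite leq_mul2r lpp orbT.
- by move=> s1 ag1 hI p l hp hl; rewrite hI // hp.
Qed.


Local Notation peel := (@peel F H D nn).
Local Notation guess_col := (@guess_col F H D nn).
Local Notation guess_after := (@guess_after F H D nn).

Lemma V_gt1 : 1 < V. Proof. exact: leq_trans (card_finNzRing_gt1 F) qV. Qed.

Lemma guess_after_le t g d : guess_after t g d <= g.
Proof.
elim: d => //= d IH; apply: leq_trans IH.
by rewrite /consume consume_div; apply: leq_div.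
Qed.

Lemma iter_peel_le r (x : (nat -> B) * nat) : (iter r peel x).2 <= x.2.
Proof. by elim: r => //= r IH; apply: leq_trans (guess_after_le _ _ _) IH. Qed.

Definition same_but_level (s s' : state) (r : nat) : Prop :=
  forall d i r' h, d < D -> i < nn d -> r' < RR -> h < H -> r' != r ->
    s' vA (cpd_addr d i r' h) = s vA (cpd_addr d i r' h).

Lemma same_but_col_level s s' d r : same_but_col s s' d r -> same_but_level s s' r.
Proof.
move=> sA d' i r' h hd hi hr hh ne; apply: sA => //.
by apply: contra ne => /eqP[_ ->].
Qed.

Lemma level_ok s r (t : nat -> B) g :
  in_level s r -> enc_tensor vT s t -> s vg 0 = g -> g < V ->
  wp (for wd < xD do p_axis ;; p_outer) (fun s' =>
    [/\ enc_tensor vT s' (peel (t, g)).1, s' vg 0 = (peel (t, g)).2,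
        forall d, d < D -> enc_col s' d r (guess_col t g d) & same_but_level s s' r]) s.
Proof.
move=> cx eT eg gV; have [bs hr er] := cx; have [_ bN bR] := bs.
apply: wp_seq.
pose I j (s' : state) := [/\ s' vg 0 = guess_after t g j,
  forall d, d < j -> d < D -> enc_col s' d r (guess_col t g d) & same_but_level s s' r].
apply: (wp_for (I := I)) => //=; rewrite ?inD.
- exact: leq_ltn_trans MD MV.
- exact: MD.
- move=> d s1 hd ag1 ed [h1 h2 h3].
  have cx1 := in_level_agree ag1 isT cx; have [bs1 _ r1] := cx1.
  have cc : in_axis s1 d r by [].
  have eT1 : enc_tensor vT s1 t by move=> p l hp hl; rewrite (ag1.1 5 isT) eT.
  apply: (wp_post _ (axis_ok cc eT1 h1 _)) => //.
    exact: leq_ltn_trans (guess_after_le _ _ _) gV.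
  move=> s2 ag2 [e1 e2 e3]; split=> //.
    move=> d'; rewrite ltnS leq_eqVlt => /orP[/eqP-> _|lt hd'] //.
    move=> i h hi hh; rewrite e3 // ?h2 //.
    by apply/eqP => -[e]; rewrite e ltnn in lt.
  by move=> d' i r' h hd' hi hr' hh ne; rewrite (same_but_col_level e3) // h3.
- move=> s1 ag1 [h1 h2 h3].
  have cx1 := in_level_agree ag1 isT cx.
  have eT1 : enc_tensor vT s1 t by move=> p l hp hl; rewrite (ag1.1 5 isT) eT.
  have eC1 d : d < D -> enc_col s1 d r (guess_col t g d) by move=> hd; apply: h2.
  apply: (wp_post _ (outer_ok cx1 eT1 eC1)) => // s2 ag2 e1; split=> //.
  + by rewrite (ag2.1 4 isT).
  + by move=> d hd i h hi hh; rewrite (ag2.1 8 isT) eC1.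
  + by move=> d i r' h hd hi hr' hh ne; rewrite (ag2.1 8 isT) h3.
Qed.

(** * One trial *)

Definition found (g : nat) : Prop :=
  forall p, p < N -> (iter RR peel (t0, g)).1 p = 0%R.

Definition trial_col (g r d : nat) : nat -> B :=
  guess_col (iter r peel (t0, g)).1 (iter r peel (t0, g)).2 d.

Definition enc_cpd (s : state) (g : nat) : Prop :=
  forall d r, d < D -> r < RR -> enc_col s d r (trial_col g r d).

Lemma try_ok s g : setup_done s -> s wgi 0 = g -> g < V ->
  wp p_try (fun s' => enc_cpd s' g /\ (s' vFD 0 != 0 <-> found g)) s.
Proof.
move=> bs eg gV; have [b1 bN bR] := bs.
have NA : N * H <= A by apply: leq_trans MN (ltnW MA).
have NV' : N * H < V by apply: leq_ltn_trans MN MV.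
apply: wp_seq; apply: wp_set => /=; first exact: leq_ltn_trans MA.
  by rewrite eg.
rewrite eg; set s1 := upd _ _ _ _; apply: wp_seq.
apply: (wp_map (n := N * H) (b := 0) (v := fun x => nth 0 inp (4 + D + x))) => //=.
- by rewrite bN inH.
- move=> x hx; have h0 : 0 < H by case: (posnP H) => // e; rewrite e muln0 in hx.
  by rewrite (divn_eq x H) inT ?codeV ?ltn_mod // ltn_divLR.
- by move=> l s2 hl ag2 el _; rewrite el inD.
move=> s2 ag2 hT _.
have bs2 : setup_done s2 by apply: setup_done_agree ag2 isT _.
have [c1 c2 c3] := bs2.
apply: wp_seq.
pose I j (s' : state) := [/\ enc_tensor vT s' (iter j peel (t0, g)).1,
  s' vg 0 = (iter j peel (t0, g)).2 &
  forall d r, d < D -> r < RR -> r < j -> enc_col s' d r (trial_col g r d)].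
apply: (wp_for (I := I)) => //=; rewrite ?c3.
- by apply: leq_ltn_trans (geq_minl _ _) RV.
- exact: leq_trans (geq_minr _ _) N_leM.
- split=> //=; last by rewrite (ag2.1 4 isT).
  by move=> p l hp hl; have := hT _ (pos_lt hl hp); rewrite add0n => ->; rewrite inT.
- move=> r s3 hr ag3 er [h1 h2 h3].
  have cx3 : in_level s3 r by split=> //; apply: setup_done_agree ag3 isT _.
  apply: (wp_post _ (level_ok cx3 h1 h2 _)) => //.
    exact: leq_ltn_trans (@iter_peel_le r (t0, g)) gV.
  move=> s4 ag4 [e1 e2 e3 e4]; rewrite /I iterS.
  move: h1 h2 e1 e2 e3; case eit: (iter r peel (t0, g)) => [t' g'] /= h1 h2 e1 e2 e3.
  split=> //.
  move=> d r' hd hr'; rewrite ltnS leq_eqVlt => /orP[/eqP->|lt].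
    by move: (e3 d hd); rewrite /trial_col eit.
  by move=> i h hi hh; rewrite e4 // ?h3 // ltn_eqF.
move=> s3 ag3 [h1 h2 h3].
have bs3 : setup_done s3 by apply: setup_done_agree ag3 isT _.
have [d1 d2 d3] := bs3.
apply: wp_seq; apply: wp_set => /=; first exact: leq_ltn_trans MA.
  exact: V_gt1.
set s4 := upd _ _ _ _; apply: wp_seq.
pose K j (s' : state) := (s' vOK 0 != 0) = all (fun x => s3 vT x == code (0%R : F)) (iota 0 j)
   /\ s' vOK 0 <= 1.
have eN x : x < N * H -> x %/ H < N /\ x %% H < H.
  move=> hx; have h0 : 0 < H by case: (posnP H) => // e; rewrite e muln0 in hx.
  by rewrite ltn_divLR // ltn_mod.
apply: (wp_for (I := K)) => //=; rewrite ?d2 ?inH //.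
- move=> j s5 hj ag5 ej [k1 k2].
  have it : iota 0 j.+1 = rcons (iota 0 j) j by rewrite -addn1 iotaD cats1.
  have eb : ev s5 (vT@[$ wx] == E0)%ex = (s3 vT j == code (0%R : F)).
    by rewrite /= (ag5.1 5 isT) ej.
  apply: wp_ifb eb _ _ => [z|nz].
    by apply: wp_skip; rewrite /K it all_rcons z.
  apply: wp_set => /=; [exact: leq_ltn_trans MA | by apply: ltn_trans V_gt1 |].
  by rewrite /K it all_rcons (negPf nz).
move=> s5 ag5 [k1 k2]; apply: wp_set => /=; first exact: leq_ltn_trans MA.
  exact: leq_ltn_trans V_gt1.
split=> [d r hd hr i h hi hh|].
  by rewrite /= (ag5.1 8 isT) /= h3.
rewrite /= k1; split=> [/allP al p hp|fd].
  apply: cf_inj => // h hh; apply: (can_inj (@codeK F)).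
  rewrite cf0 -h1 //; apply/eqP/al; rewrite mem_iota add0n /=.
  exact: pos_lt.
apply/allP => x; rewrite mem_iota add0n /= => /eN[hp hh].
by rewrite (divn_eq x H) h1 // fd // cf0.
Qed.

Lemma sz_ltV e : e <= D -> sz D nn e < V.
Proof.
rewrite leq_eqVlt => /orP[/eqP->|he]; first by rewrite szD V_gt1.
case: (posnP N) => N0.
  have n0 : nn e = 0 by apply/eqP; rewrite -leqn0 -N0; apply: nnN.
  by rewrite szE // n0 mul0n (ltn_trans _ V_gt1).
apply: leq_ltn_trans (leq_ltn_trans N_leM MV); apply: dvdn_leq => //.
exact: sz_dvd (leq0n _) (ltnW he).
Qed.

Local Notation budget := (budget D nn).

(** * Setup of the search *)

Lemma budgetS r : budget r.+1 = budget r + \sum_(0 <= d < D) minn r.+1 (nn d).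
Proof. by rewrite {1}/budget big_nat_recr //= big_mkord. Qed.

Lemma budget_le r r' : r <= r' -> budget r <= budget r'.
Proof.
elim: r' => [|r' IH]; first by rewrite leqn0 => /eqP->.
rewrite leq_eqVlt => /orP[/eqP->//|/IH h].
by rewrite budgetS; apply: leq_trans h (leq_addr _ _).
Qed.

(** Keeps the intermediate powers of [p_setup] within the final one, hence below V. *)
Lemma sum_min_le r d i : d < D -> i < nn d ->
  \sum_(0 <= e < d) minn r.+1 (nn e) + minn r.+1 i.+1 <=
  \sum_(0 <= e < D) minn r.+1 (nn e).
Proof.
move=> hd hi; rewrite (big_cat_nat (leq0n d) (ltnW hd)) //= leq_add2l big_ltn //.
by apply: leq_trans (leq_addr _ _); rewrite leq_min geq_minl (leq_trans (geq_minr _ _) hi).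
Qed.

Lemma setup_ok s :
  wp p_setup (fun s' => setup_done s' /\ s' vG 0 = q ^ (H * budget RR)) s.
Proof.
have A0 : 0 < A by apply: leq_ltn_trans MA.
apply: wp_seq; apply: wp_set => //=; first exact: V_gt1.
apply: wp_seq.
pose I j (s' : state) := s' vNN 0 = sz D nn (D - j) /\
  forall d, D - j <= d -> d < D -> s' vST d = stride_of d.
apply: (wp_for (I := I)) => //=; rewrite ?inD.
- exact: leq_ltn_trans MD MV.
- exact: MD.
- rewrite /I /= subn0 szD; split=> // d h1 h2; lia.
- move=> j s1 hj ag1 ej [h1 h2].
  have e1 : D - j = (D - (1 + j)).+1 by lia.
  have hd : D - (1 + j) < D by lia.
  apply: wp_seq; apply: wp_set => /=; rewrite ?inD ?ej.
  + exact: leq_trans hd (leq_trans MD (ltnW MA)).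
  + by rewrite h1; apply: sz_ltV; apply: leq_subr.
  apply: wp_set => //=; rewrite ?inD ?ej inn // h1 e1 mulnC -szE //.
    exact: sz_ltV (ltnW hd).
  rewrite /I /= subnS -subn1 -subnDA addnC; split=> // d d1 d2.
  case: eqP => [->|nd]; first by rewrite ?h1 ?e1.
  by rewrite h2 //; lia.
move=> s1 ag1 [h1 h2]; rewrite subnn in h1 h2.
apply: wp_seq.
suff main s2 : setup_done s2 -> wp (put vG (EC 0) := EC 1 ;;
  for wr < ($ vRR) do for wd < xD do for wi < xn ($ wd)%ex do
    SIf ($ wr < $ wi)%ex SSkip (for wl < xH do put vG (EC 0) := $ vG * xq))
    (fun s' => setup_done s' /\ s' vG 0 = q ^ (H * budget RR)) s2.
  apply: (@wp_ifb _ _ _ (R < N)) => [|lt|ge]; first by rewrite /= inR h1.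
    apply: wp_set => //=; rewrite inR; first exact: RV.
    by apply: main; split=> //= [d hd|]; [rewrite h2 | rewrite (minn_idPl (ltnW lt))].
  apply: wp_set => //=; rewrite h1; first exact: leq_ltn_trans N_leM MV.
  apply: main; split=> //= [d hd|]; [by rewrite h2 | rewrite (minn_idPr _) //].
  by rewrite leqNgt.
move=> bs2; apply: wp_seq; apply: wp_set => //=; first exact: V_gt1.
have [_ _ bR] := bs2.
pose L1 r (s' : state) := s' vG 0 = q ^ (H * budget r).
apply: (wp_for (I := L1)) => //=; rewrite ?bR.
- exact: leq_ltn_trans (geq_minl _ _) RV.
- exact: leq_trans (geq_minr _ _) N_leM.
- by rewrite /L1 /= /budget big_geq // muln0.
- move=> r s3 hr ag3 er hL1.
  pose L2 d (s' : state) :=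
    s' vG 0 = q ^ (H * (budget r + \sum_(0 <= e < d) minn r.+1 (nn e))).
  apply: (wp_for (I := L2)) => //=; rewrite ?inD.
  + exact: leq_ltn_trans MD MV.
  + exact: MD.
  + by rewrite /L2 big_geq // addn0.
  + move=> d s4 hd ag4 ed hL2.
    have bs4 : setup_done s4.
      by apply: setup_done_agree ag4 isT _; apply: setup_done_agree ag3 isT _.
    have er4 : s4 18 0 = r by rewrite (ag4.1 18 isT).
    have eb4 : nth 0 inp (4 + s4 19 0) = nn d by rewrite ed inn.
    pose L3 i (s' : state) :=
      s' vG 0 = q ^ (H * (budget r + (\sum_(0 <= e < d) minn r.+1 (nn e) + minn r.+1 i))).
    apply: (wp_for (I := L3)) => //=; rewrite ?eb4.
    * by apply: leq_ltn_trans (leq_trans (nnN hd) N_leM) MV.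
    * exact: leq_trans (nnN hd) N_leM.
    * by rewrite /L3 minn0 addn0.
    * move=> i s5 hi ag5 ei hL3.
      have N0 : 0 < N by apply: leq_trans (nnN hd); apply: leq_ltn_trans hi.
      have H_leM := H_leM N0.
      apply: (@wp_ifb _ _ _ (r < i)) => [|lt|ge].
      - by rewrite /= (ag5.1 18 isT) er4 ei.
      - apply: wp_skip; rewrite /L3 hL3; congr (q ^ (H * (_ + (_ + _)))).
        by rewrite (minn_idPl _) 1?(minn_idPl _) // ltnW.
      rewrite -leqNgt in ge.
      pose X := budget r + (\sum_(0 <= e < d) minn r.+1 (nn e) + minn r.+1 i).
      have XS : budget r + (\sum_(0 <= e < d) minn r.+1 (nn e) + minn r.+1 i.+1) = X.+1.
        by rewrite /X (minn_idPr _) // (minn_idPr _) ?leqW // !addnS.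
      have Xle : X.+1 <= budget RR.
        apply: leq_trans (budget_le hr); rewrite -XS budgetS leq_add2l.
        exact: sum_min_le.
      pose L4 l (s' : state) := s' vG 0 = q ^ (H * X + l).
      apply: (wp_for (I := L4)) => //=; rewrite ?inH.
      - exact: leq_ltn_trans H_leM MV.
      - exact: H_leM.
      - by rewrite /L4 hL3 addn0.
      - move=> l s6 hl ag6 el hL4.
        apply: wp_set => //=; rewrite hL4 inq -expnSr; last by rewrite /L4 /= addnS.
        apply: leq_ltn_trans GV; rewrite leq_pexp2l ?cardF_gt0 //.
        apply: leq_trans (leq_mul (leqnn H) Xle); rewrite mulnS addnC -addSn leq_add2r //.
      - by move=> s6 ag6; rewrite /L4 /L3 XS mulnS addnC.
    * move=> s5 ag5; rewrite /L3 /L2 => ->; congr (q ^ (H * (_ + _))).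
      by rewrite big_nat_recr.
  + by move=> s4 ag4; rewrite /L2 /L1 => ->; rewrite -budgetS.
- move=> s3 ag3 hL; split=> //; apply: setup_done_agree ag3 isT _; by [].
Qed.

(** * Output, main loop and scalar case *)

Definition collect (f : nat -> seq nat) (n : nat) : seq nat :=
  flatten [seq f x | x <- iota 0 n].

Lemma collectS f n : collect f n.+1 = collect f n ++ f n.
Proof.
by rewrite /collect -addn1 iotaD map_cat flatten_cat /= cats0.
Qed.

Definition acoef (g d i r h : nat) : nat :=
  code (if r < RR then cf (trial_col g r d i) h else 0%R).

Definition cpd_out (g : nat) : seq nat :=
  collect (fun d => collect (fun i => collect (fun r => collect (fun h =>
    [:: acoef g d i r h]) H) R) (nn d)) D.

Lemma emit_ok s g : setup_done s -> enc_cpd s g ->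
  wp p_emit (fun s' => ou s' = ou s ++ cpd_out g) s.
Proof.
move=> bs eA.
pose f3 d i r := collect (fun h => [:: acoef g d i r h]) H.
pose f2 d i := collect (f3 d i) R.
pose f1 d := collect (f2 d) (nn d).
apply: (wp_for (I := fun j (s' : state) => ou s' = ou s ++ collect f1 j)) => //=; rewrite ?inD.
- exact: leq_ltn_trans MD MV.
- exact: MD.
- by rewrite cats0.
- move=> d s1 hd ag1 ed h1.
  have eb1 : nth 0 inp (4 + s1 19 0) = nn d by rewrite ed inn.
  rewrite collectS catA -h1.
  apply: (wp_for (I := fun j (s' : state) => ou s' = ou s1 ++ collect (f2 d) j)) => //=;
    rewrite ?eb1.
  + by apply: leq_ltn_trans (leq_trans (nnN hd) N_leM) MV.
  + exact: leq_trans (nnN hd) N_leM.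
  + by rewrite cats0.
  + move=> i s2 hi ag2 ei h2.
    have N0 : 0 < N by apply: leq_trans (nnN hd); apply: leq_ltn_trans hi.
    have H_leM := H_leM N0.
    rewrite collectS catA -h2.
    apply: (wp_for (I := fun j (s' : state) => ou s' = ou s2 ++ collect (f3 d i) j)) => //=;
      rewrite ?inR.
    * exact: RV.
    * exact: RGB (leq_ltn_trans (leq0n _) hd) N0.
    * by rewrite cats0.
    * move=> r s3 hr ag3 er h3.
      have bs3 : setup_done s3.
        by apply: setup_done_agree ag3 isT _; apply: setup_done_agree ag2 isT _; apply: setup_done_agree ag1 isT bs.
      have [b1 b2 b3] := bs3.
      have ed3 : s3 19 0 = d by rewrite (ag3.1 19 isT) (ag2.1 19 isT).
      have ei3 : s3 22 0 = i by rewrite (ag3.1 22 isT).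
      rewrite collectS catA -h3.
      apply: (@wp_ifb _ _ _ (r < RR)); first by rewrite /= er b3.
        move=> lt.
        apply: (wp_for (I := fun j (s' : state) => ou s' = ou s3 ++
          collect (fun h => [:: acoef g d i r h]) j)) => //=; rewrite ?inH.
        + exact: leq_ltn_trans H_leM MV.
        + exact: H_leM.
        + by rewrite cats0.
        + move=> h s4 hh ag4 eh h4; split=> //.
          rewrite collectS catA -h4 /= cats1; congr rcons.
          rewrite (ag4.1 19 isT) (ag4.1 1 isT) (ag4.1 22 isT) (ag4.1 2 isT) (ag4.1 18 isT).
          rewrite eh ed3 b2 ei3 b3 er inH (ag4.1 8 isT) (ag3.1 8 isT) (ag2.1 8 isT) (ag1.1 8 isT).
          by rewrite -/(cpd_addr d i r h) eA // /acoef lt.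
        by [].
      move=> ge.
      apply: (wp_for (I := fun j (s' : state) => ou s' = ou s3 ++
          collect (fun h => [:: acoef g d i r h]) j)) => //=; rewrite ?inH.
      + exact: leq_ltn_trans H_leM MV.
      + exact: H_leM.
      + by rewrite cats0.
      + move=> h s4 hh ag4 eh h4; split=> //.
        by rewrite collectS catA -h4 /= cats1 /acoef (negPf ge).
      by [].
    by [].
  by [].
by [].
Qed.

Lemma main_ok s : ou s = [::] ->
  wp p_main (fun s' =>
    (exists2 g, found g & ou s' = 1 :: cpd_out g) \/
    ((forall g, g < q ^ (H * budget RR) -> ~ found g) /\ ou s' = [:: 0])) s.
Proof.
move=> os; have A0 : 0 < A by apply: leq_ltn_trans MA.
apply: wp_seq; apply: (wp_post _ (setup_ok s)) => // s1 ag1 [bs1 eG].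
have o1 : ou s1 = [::] by rewrite ag1.2.
apply: wp_seq; apply: wp_set => //=; first exact: ltn_trans V_gt1.
apply: wp_seq.
(* After a success the remaining trials are skipped, so memory keeps the columns of the successful
   guess. *)
pose I j (s' : state) := if s' vFD 0 == 0 then forall g, g < j -> ~ found g
  else exists2 g, found g & enc_cpd s' g.
apply: (wp_for (I := I)) => //=; rewrite ?eG //.
- move=> g s2 hg ag2 eg hI.
  have bs2 : setup_done s2.
    by apply: setup_done_agree ag2 isT _.
  apply: wp_if => /= [nz|z].
    by apply: wp_skip; move: hI; rewrite /I (negPf nz).
  move: hI; rewrite /I z eqxx => hI.
  apply: (wp_post _ (try_ok bs2 eg _)) => //; first exact: ltn_trans hg GV.
  move=> s3 ag3 [eA fd]; case: eqP => [e0|/eqP n0]; last by exists g => //; apply/fd.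
  move=> g'; rewrite ltnS leq_eqVlt => /orP[/eqP->|]; last exact: hI.
  by move=> /fd; rewrite e0.
move=> s2 ag2 hI.
have bs2 : setup_done s2 by apply: setup_done_agree ag2 isT _.
have o2 : ou s2 = [::] by rewrite ag2.2.
apply: wp_if => /= nz.
  move: hI; rewrite /I (negPf nz) => -[g fg eA].
  apply: wp_seq; split=> //=.
  have := @emit_ok (emit s2 1) g bs2 eA; rewrite /= o2 => em.
  by apply: (wp_post _ em) => // s3 ag3 e; left; exists g.
by move: hI; rewrite /I nz eqxx => h; split=> //=; right; rewrite o2.
Qed.

Lemma scalar_ok s : D = 0 -> nbits R <= M -> ou s = [::] ->
  wp p_scalar (fun s' => ou s' = [:: nat_of_bool (t0 0 == R%:R%R)]) s.
Proof.
move=> D0 RM os; have A0 : 0 < A by apply: leq_ltn_trans MA.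
have N1 : N = 1 by rewrite /sz big_geq // D0.
have H_leM : H <= M by apply: H_leM; rewrite N1.
have iT h : h < H -> nth 0 inp (4 + h) = code (cf (t0 0) h).
  by move=> hh; rewrite -inT ?N1 // D0.
do 2!(apply: wp_seq; apply: wp_set; [exact: A0 | exact: codeV |]).
apply: wp_seq; apply: wp_set => //=; first by rewrite inR; exact: RV.
set s1 := upd _ _ _ _; apply: wp_seq.
(* The binary digits of R are added from the lowest on. *)
pose I j (s' : state) := [/\ s' vg 0 = R %/ 2 ^ j,
  s' vW 0 = code ((R %% 2 ^ j)%:R%R : F) & s' vY 0 = code ((2 ^ j)%:R%R : F)].
apply: (wp_half (I := I)) => //=; rewrite ?inR //.
- by split; rewrite /= ?inR ?divn1 // modn1.
- move=> j s2 ag2 [h1 h2 h3].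
  apply: wp_seq.
  have stride : R %% 2 ^ j.+1 = R %/ 2 ^ j %% 2 * 2 ^ j + R %% 2 ^ j.
    rewrite {1}(divn_eq (R %% 2 ^ j.+1) (2 ^ j)) expnS modn_dvdm ?dvdn_mull //.
    by rewrite -modn_divl.
  have k2 (s3 : state) : s3 vg 0 = R %/ 2 ^ j -> s3 vW 0 = code ((R %% 2 ^ j.+1)%:R%R : F) ->
      s3 vY 0 = code ((2 ^ j)%:R%R : F) ->
      wp (put vY (EC 0) := EF FAdd ($ vY) ($ vY) ;; put vg (EC 0) := $ vg / EC 2)
         (I j.+1) s3.
    move=> e1 e2 e3; apply: wp_seq; apply: wp_set => //=; first exact: codeV.
    apply: wp_set => //=; rewrite e1 -divnMA -expnSr.
      by apply: leq_ltn_trans (leq_div _ _) RV.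
    by split=> //=; rewrite e3 !codeK -natrD addnn -mul2n -expnS.
  apply: wp_if => /=; rewrite h1 => par.
    apply: wp_set => //=; first exact: codeV.
    apply: k2 => //=; rewrite h2 h3 !codeK -natrD stride addnC; congr (code (_ + _)%:R)%R.
    have := ltn_pmod (R %/ 2 ^ j) (isT : 0 < 2).
    by case: (_ %% 2) par => [|[|]] // _ _; rewrite mul1n.
  by apply: wp_skip; apply: k2 => //; rewrite h2 stride par.
move=> s2 ag2 [h1 h2 h3].
have eR : R %% 2 ^ nbits R = R.
  have z : R %/ 2 ^ nbits R = 0 by apply/eqP; rewrite -[_ == _]negbK div_nbits ltnn.
  by rewrite [RHS](divn_eq R (2 ^ nbits R)) z.
rewrite eR in h2.
apply: wp_seq; apply: wp_set => //=; first exact: V_gt1.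
set s3 := upd _ _ _ _; apply: wp_seq.
pose c0 := cf (t0 0) 0 == (R%:R)%R.
suff fin (s4 : state) : s4 vOK 0 = c0 :> nat -> ou s4 = [::] -> wp
    (for wl < (xH - EC 1) do
        SIf (EI (EC 5 + $ wl) == E0)%ex SSkip (put vOK (EC 0) := EC 0) ;;
     SIf ($ vOK)%ex (SEmit (EC 1)) (SEmit (EC 0)))
   (fun s' => ou s' = [:: nat_of_bool (t0 0 == R%:R%R)]) s4.
  have o2 : ou s2 = [::] by rewrite ag2.2.
  apply: (@wp_ifb _ _ _ c0) => [|e|ne].
  - by rewrite /= iT // h2 (inj_eq (can_inj (@codeK F))).
  - by apply: wp_skip; apply: fin => //=; rewrite e.
  - apply: wp_set => //=; first exact: ltn_trans V_gt1.
    by apply: fin => //=; rewrite (negPf ne).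
move=> e4 o4; apply: wp_seq.
pose K j (s' : state) := s' vOK 0 = (c0 && all (fun h => cf (t0 0) h == 0%R) (iota 1 j)).
apply: (wp_for (I := K)) => //=; rewrite ?inH.
- exact: leq_ltn_trans (leq_subr _ _) (leq_ltn_trans H_leM MV).
- exact: leq_trans (leq_subr _ _) H_leM.
- by rewrite /K e4 andbT.
- move=> j s5 hj ag5 ej hK.
  have it : iota 1 j.+1 = rcons (iota 1 j) j.+1 by rewrite -[j.+1 in LHS]addn1 iotaD cats1 add1n.
  have jH : j.+1 < H by move: hj; rewrite ltn_subRL add1n.
  apply: (@wp_ifb _ _ _ (cf (t0 0) j.+1 == 0%R)) => [|e|ne].
  + by rewrite /= ej -[5 + j]/(4 + j.+1) iT // (inj_eq (can_inj (@codeK F))).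
  + by apply: wp_skip; rewrite /K it all_rcons e.
  + apply: wp_set => //=; first exact: ltn_trans V_gt1.
    by rewrite /K it all_rcons /= (negPf ne) andbF.
move=> s5 ag5; rewrite /K => hK.
have o5 : ou s5 = [::] by rewrite ag5.2.
have eb : (c0 && all (fun h => cf (t0 0) h == 0%R) (iota 1 (H - 1))) = (t0 0 == R%:R%R).
  apply/andP/eqP => [[/eqP e0 /allP al]|e].
    apply: cf_inj => // -[|h] hh; rewrite cf_natr //=.
    by apply/eqP/al; rewrite mem_iota add1n subn1 prednK.
  split; first by rewrite /c0 e cf_natr.
  by apply/allP => h; rewrite mem_iota e cf_natr; case: h.
rewrite eb in hK.
apply: (@wp_ifb _ _ _ (t0 0 == R%:R%R)) => [|->|/negPf->]; first by rewrite /= hK.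
  by split=> //=; rewrite o5.
by split=> //=; rewrite o5.
Qed.

End Run.

(** * Encodings of tensors and decompositions *)

Section Glue.

Variables (F : finFieldType) (H D : nat) (n : 'I_D -> nat).
Local Notation B := (truncpoly F H).
Local Notation q := #|F|.
Variables (T : tensor B n) (R : nat).
Hypothesis H0 : 0 < H.
Hypothesis cT : concise T.

Definition nn (k : nat) : nat := if insub k is Some d then n d else 0.

Lemma nnE (d : 'I_D) : nn d = n d.
Proof. by rewrite /nn valK. Qed.

Local Notation N := (sz D nn 0).

Lemma NE : N = \prod_(d < D) n d.
Proof. by rewrite /sz big_mkord; apply: eq_bigr => d _; rewrite nnE. Qed.

Lemma dig_lt (p : 'I_N) (d : 'I_D) : idx D nn d p < n d.
Proof. by rewrite -nnE; apply: (idx_lt (ltn_ord d) (ltn_ord p)). Qed.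

Definition midx_at (p : 'I_N) : midx n := [ffun d => Ordinal (dig_lt p d)].

Lemma midx_atE p d : midx_at p d = idx D nn d p :> nat.
Proof. by rewrite ffunE. Qed.

Lemma midx_pos_at p : midx_pos (midx_at p) = p.
Proof.
rewrite -[RHS](pos_sum (ltn_ord p)) big_mkord /midx_pos.
apply: eq_bigr => d _; rewrite midx_atE; congr (_ * _).
rewrite /stride /sz big_geq_mkord; apply: eq_bigr => e _.
by rewrite nnE.
Qed.

Lemma midx_at_inj : injective midx_at.
Proof. by move=> p p' e; apply: val_inj; rewrite /= -!midx_pos_at e. Qed.

Lemma card_midx : #|{: midx n}| = N.
Proof.
by rewrite card_dep_ffun NE foldrE big_image /=; apply: eq_bigr => d _; rewrite card_ord.
Qed.

Lemma midx_at_bij : bijective midx_at.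
Proof. by apply: inj_card_bij midx_at_inj _; rewrite card_midx card_ord. Qed.

Lemma midx_at_onto (i : midx n) : exists p, midx_at p = i.
Proof. by have [g _ gK] := midx_at_bij; exists (g i). Qed.

(** Both lists have the same elements and are sorted by the injective key [midx_pos]. *)
Lemma midx_listE : midx_list n = map midx_at (enum 'I_N).
Proof.
have pinj : injective (@midx_pos D n).
  move=> i j; have [p <-] := midx_at_onto i; have [p' <-] := midx_at_onto j.
  by rewrite !midx_pos_at => /val_inj->.
apply: (@sorted_eq _ (fun i j => midx_pos i <= midx_pos j)).
- by move=> i j k; apply: leq_trans.
- by move=> i j /anti_leq/pinj.
- by apply: sort_sorted => i j; apply: leq_total.
- rewrite sorted_map; have -> : sorted (relpre midx_at (fun i j => midx_pos i <= midx_pos j)) (enum 'I_N)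
      = sorted (relpre val leq) (enum 'I_N).
    by apply: eq_sorted => p p'; rewrite /= !midx_pos_at.
  by rewrite -sorted_map val_enum_ord; apply: iota_sorted.
- rewrite perm_sort; apply: uniq_perm.
  + exact: enum_uniq.
  + by rewrite map_inj_uniq ?enum_uniq //; apply: midx_at_inj.
  + move=> i; have [p <-] := midx_at_onto i.
    by rewrite !mem_enum inE (map_f midx_at) // mem_enum.
Qed.

Definition t0 (p : nat) : B := if insub p is Some p' then T (midx_at p') else 0%R.

Lemma t0E (p : 'I_N) : t0 p = T (midx_at p).
Proof. by rewrite /t0 valK. Qed.

Local Notation inp := (encode_input T R).

Lemma nth_flatten_const (m : nat) (ss : seq (seq nat)) p h :
  all (fun s => size s == m) ss -> h < m -> p < size ss ->
  nth 0 (flatten ss) (p * m + h) = nth 0 (nth [::] ss p) h.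
Proof.
elim: ss p => [//|s ss IH] p /= /andP[/eqP sm al] hm hp.
rewrite nth_cat; case: p hp => [|p] hp; first by rewrite mul0n add0n sm hm.
by rewrite sm mulSn -addnA ltnNge leq_addr /= addKn IH.
Qed.

Lemma inn d : d < D -> nth 0 inp (4 + d) = nn d.
Proof.
move=> hd; rewrite /encode_input nth_cat [size _]/= ltnNge leq_addr addKn.
rewrite nth_cat size_map size_enum_ord hd.
rewrite (nth_map (Ordinal hd)) ?size_enum_ord // -nnE nth_enum_ord //.
Qed.

Lemma inT p h : p < N -> h < H -> nth 0 inp (4 + D + (p * H + h)) = code (cf (t0 p) h).
Proof.
move=> hp hh; rewrite /encode_input -addnA nth_cat [size _]/= ltnNge leq_addr addKn.
rewrite nth_cat size_map size_enum_ord ltnNge leq_addr /= addKn.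
rewrite midx_listE -map_comp (nth_flatten_const (m := H)) //; last first.
- by rewrite size_map size_enum_ord.
- by apply/allP => s /mapP[x _ ->]; rewrite /encode_elt size_map size_iota.
rewrite (nth_map (Ordinal hp)) ?size_enum_ord //= (nth_map 0) ?size_iota // nth_iota //.
have -> : nth (Ordinal hp) (enum 'I_N) p = Ordinal hp by apply: val_inj; rewrite /= nth_enum_ord.
by rewrite add0n -t0E.
Qed.

Lemma size_inp : size inp = 4 + D + N * H.
Proof.
rewrite /encode_input !size_cat size_map size_enum_ord /= addnA; congr (_ + _).
rewrite midx_listE -map_comp size_flatten /shape -map_comp.
rewrite (eq_map (g := fun=> H)); last by move=> p /=; rewrite /encode_elt size_map size_iota.
by rewrite sumnE big_map big_const_seq count_predT size_enum_ord iter_addn_0 mulnC.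
Qed.

(** If N = 0, some axis e is empty. The unfolding along any other axis d then has no columns and
    factors through 0, so conciseness forces n_d = 0. Without this, a loop over an axis could be
    longer than any polynomial in the input size. *)
Lemma nnN d : d < D -> nn d <= N.
Proof.
move=> hd; case: (posnP N) => N0; last first.
  apply: dvdn_leq => //; apply: dvdn_trans (sz_dvd nn (leq0n _) (ltnW hd)).
  by rewrite szE // dvdn_mulr.
rewrite N0 leqn0; apply: contraTT isT => nd0.
have [e e0] : exists e : 'I_D, n e = 0.
  move: N0; rewrite NE => /eqP; rewrite -[_ == 0]negbK -lt0n.
  have [/existsP[e /eqP ne]|no] := boolP [exists e : 'I_D, n e == 0]; first by exists e.
  case/negP; rewrite prodn_gt0 // => e; rewrite lt0n.
  by move: no; rewrite negb_exists => /forallP/(_ e).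
have nd : nn d = n (Ordinal hd) by rewrite -nnE.
have ne : e != Ordinal hd by apply: contraNneq nd0 => ed; rewrite nd -ed e0.
have [_ /(_ 0) min] := cT (Ordinal hd).
suff f0 : factors_through (unfolding T (Ordinal hd)) 0.
  by move: nd0; rewrite nd -leqn0 min.
exists 0%R, 0%R; apply/matrixP => i j; have := enum_val j => m.
by have := ltn_ord (m (exist _ e ne)); rewrite /= {2}e0.
Qed.

Local Notation RR := (minn R N).
Local Notation flat_cpd := (flat_cpd D nn t0).
Local Notation mats r := (forall d : 'I_D, 'M[B]_(n d, r)).

Lemma flat_cpd_of_cpd r (A : mats r) : is_cpd T A -> exists A', flat_cpd r A'.
Proof.
move=> cA; pose A' d i s : B :=
  if insub d is Some d' then
    if (insub i, insub s) is (Some i', Some s') then A d' i' s' else 0%R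
  else 0%R.
exists A' => p hp; rewrite (t0E (Ordinal hp)) cA; apply: eq_bigr => s _.
apply: eq_bigr => d _; rewrite /A' valK -[idx D nn d p](midx_atE (Ordinal hp) d).
by rewrite !valK.
Qed.

Lemma cpd_of_flat_cpd r A' : flat_cpd r A' -> is_cpd T (fun d : 'I_D => \matrix_(i < n d, s < r) A' d i s)%R.
Proof.
move=> cA i; have [p <-] := midx_at_onto i; rewrite -t0E cA //.
by apply: eq_bigr => s _; apply: eq_bigr => d _; rewrite mxE midx_atE.
Qed.

(** A zero column kills its term through axis 0; with no axis the empty product would be 1. *)
Lemma flat_cpd_widen r r' A : 0 < D -> r <= r' -> flat_cpd r A ->
  flat_cpd r' (fun d i s => if s < r then A d i s else 0%R).
Proof.
move=> D0 rr cA p hp; rewrite cA // (big_ord_widen _ (fun s => \prod_(d < D) A d (idx D nn d p) s)%R rr) big_mkcond.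
apply: eq_bigr => s _; case: ifP => // _.
by rewrite (bigD1 (Ordinal D0)) //= mul0r.
Qed.

(** Term s is the indicator of position s, with the coefficient of the tensor placed on axis 0. *)
Lemma flat_cpd_full : 0 < D ->
  flat_cpd N (fun d i s => if i == idx D nn d s then (if d == 0 then t0 s else 1) else 0)%R.
Proof.
move=> D0 p hp; rewrite (bigD1 (Ordinal hp)) //= [X in (_ + X)%R]big1 => [|s ne].
  rewrite addr0 (bigD1 (Ordinal D0)) //= eqxx big1 ?mulr1 // => d d0.
  by rewrite eqxx ifN.
have [/existsP[d nd]|/existsPn eq] := boolP [exists d : 'I_D, idx D nn d p != idx D nn d s].
  by rewrite (bigD1 d) //= (negPf nd) mul0r.
case/eqP: ne; apply: val_inj; rewrite /= -(pos_sum hp) -(pos_sum (ltn_ord s)) !big_mkord.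
by apply: eq_bigr => d _; have := eq d; rewrite negbK => /eqP->.
Qed.

Lemma collect_enum m (f : nat -> seq nat) : flatten [seq f (val x) | x <- enum 'I_m] = collect f m.
Proof. by rewrite /collect -val_enum_ord -map_comp. Qed.

Lemma encode_cpdE (f : nat -> nat -> nat -> B) :
  encode_cpd (fun d : 'I_D => \matrix_(i < n d, s < R) f d i s)%R =
  collect (fun d => collect (fun i => collect (fun r => collect (fun h =>
    [:: code (cf (f d i r) h)]) H) R) (nn d)) D.
Proof.
rewrite /encode_cpd -collect_enum; congr flatten; apply: eq_map => d /=.
rewrite nnE -collect_enum; congr flatten; apply: eq_map => i /=.
rewrite -collect_enum; congr flatten; apply: eq_map => r /=.
by rewrite mxE /collect flatten_map1.
Qed.

(** A CPD found under the cap is padded with zero columns. Conversely, an R-term CPD yields one of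
    the capped size: itself if R < N, the full one otherwise. *)
Lemma main_correct out : 0 < D ->
  (exists2 g, found D R nn t0 g & out = 1 :: cpd_out D R nn t0 g) \/
  ((forall g, g < q ^ (H * budget D nn RR) -> ~ found D R nn t0 g) /\ out = [:: 0]) ->
  correct_answer T R out.
Proof.
move=> D0 [[g fg ->]|[nf ->]]; [left|right; split=> //].
  pose f d i r : B := (if (r < RR)%N then trial_col D nn t0 g r d i else 0)%R.
  exists (fun d : 'I_D => \matrix_(i < n d, s < R) f d i s)%R; split.
    apply: cpd_of_flat_cpd; apply: flat_cpd_widen (geq_minl _ _) _ => // p hp.
    by rewrite (search_sound t0 RR g hp) fg // add0r.
  rewrite encode_cpdE; congr (_ :: _); rewrite /cpd_out /collect.
  congr flatten; apply: eq_map => d; congr flatten; apply: eq_map => i.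
  congr flatten; apply: eq_map => r; congr flatten; apply: eq_map => h.
  by rewrite /acoef /f; case: ifP => // _; rewrite cf0.
move=> [A /flat_cpd_of_cpd[A' cA]].
have [A'' cA''] : exists A'', flat_cpd RR A''.
  rewrite /minn; case: ltnP => _; first by exists A'.
  by eexists; exact: flat_cpd_full.
by have [g hg fg] := search_complete H0 cA''; apply: nf hg fg.
Qed.

Lemma scalar_correct : D = 0 ->
  correct_answer T R [:: nat_of_bool (t0 0 == R%:R%R)].
Proof.
move=> D0; have N1 : N = 1 by rewrite /sz big_geq // D0.
have hp : 0 < N by rewrite N1.
have iff (A : mats R) : is_cpd T A <-> t0 0 = R%:R%R.
  have prod1 i : (\sum_(r < R) \prod_(d < D) A d (i d) r)%R = R%:R%R :> B.
    rewrite (eq_bigr (fun=> 1%R)) => [|r _].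
      by rewrite sumr_const card_ord.
    by rewrite big1 // => d; have := ltn_ord d; rewrite {2}D0.
  split=> [c|e i]; first by rewrite (t0E (Ordinal hp)) c prod1.
  have [p <-] := midx_at_onto i; rewrite prod1 -e -t0E; congr t0.
  by have := ltn_ord p; rewrite {2}N1; case: (val p).
case: eqP => e /=.
  left; exists (fun d => 0%R); split; first exact/iff.
  have e0 : enum 'I_D = [::] by apply: size0nil; rewrite size_enum_ord.
  by rewrite /encode_cpd e0.
by right; split=> // -[A /iff].
Qed.

End Glue.

(** * Resource bounds *)

Lemma bits_cons x s : bits (x :: s) = (trunc_log 2 x).+1 + bits s.
Proof. by rewrite /bits big_cons. Qed.

Lemma size_bits s : size s <= bits s.
Proof. by elim: s => //= x s IH; rewrite bits_cons addSn ltnS (leq_trans IH) ?leq_addl. Qed.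

Lemma mem_bits s x : x \in s -> (trunc_log 2 x).+1 <= bits s.
Proof.
elim: s => //= y s IH; rewrite inE bits_cons => /orP[/eqP->|/IH h]; first exact: leq_addr.
exact: leq_trans h (leq_addl _ _).
Qed.

Lemma mem_lt s x : x \in s -> x < 2 ^ bits s.
Proof.
move=> /mem_bits h; apply: leq_trans (@trunc_log_ltn 2 x isT) _.
by rewrite leq_pexp2l.
Qed.

Section Final.

Variables (F : finFieldType) (H D : nat) (n : 'I_D -> nat).
Local Notation q := #|F|.
Variables (T : tensor (truncpoly F H) n) (R : nat).
Hypothesis H0 : 0 < H.
Hypothesis cT : concise T.
Local Notation inp := (encode_input T R).
Local Notation len := (bits inp).
Local Notation N := (sz D (nn n) 0).
Local Notation RR := (minn R N).
Local Notation budget := (budget D (nn n)).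
(** A exceeds both [len] and D N RR H <= len ^ 3, the size of the stored CPD. V exceeds the number
    of guesses, at most (2 ^ len) ^ (len ^ 3). GB is stated with R rather than its cap, as in the
    theorem, so that it also bounds the printing. *)
Local Notation A := (len ^ 3 + len + 1).
Local Notation V := (2 ^ (len ^ 4 + 1)).
Local Notation GB := (q ^ (H * budget R)).

Definition st0 : state := State (fun _ _ => 0) [::].

Lemma size_len : 4 + D + N * H <= len.
Proof. by rewrite -(size_inp T R); apply: size_bits. Qed.

Lemma D_len : D <= len. Proof. have := size_len; lia. Qed.
Lemma NH_len : N * H <= len. Proof. have := size_len; lia. Qed.
Lemma N_len : N <= len. Proof. by apply: leq_trans NH_len; apply: leq_pmulr. Qed.
Lemma len_gt1 : 1 < len. Proof. have := size_len; lia. Qed.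

Lemma q_lt : q < 2 ^ len. Proof. by apply: mem_lt; rewrite /encode_input inE eqxx. Qed.

Lemma R_in : R \in inp. Proof. by rewrite /encode_input !inE eqxx !orbT. Qed.

Lemma budget_bound : H * budget RR <= len ^ 3.
Proof.
have b : budget RR <= RR * (D * N).
  rewrite /budget; apply: (@leq_trans (\sum_(1 <= s < RR.+1) D * N)).
    have -> : D * N = \sum_(d < D) N by rewrite sum_nat_const card_ord.
    apply: leq_sum => s _.
    by apply: leq_sum => d _; apply: leq_trans (geq_minr _ _) (nnN cT (ltn_ord d)).
  by rewrite sum_nat_const_nat subSS subn0.
apply: (@leq_trans (H * (N * (D * N)))).
  rewrite leq_mul2l; apply/orP; right; apply: leq_trans b _.
  by rewrite leq_mul2r geq_minr orbT.
rewrite mulnA [H * N]mulnC !expnS expn0 muln1.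
by apply: leq_mul NH_len (leq_mul D_len N_len).
Qed.

Lemma V_gt : 2 ^ len < V.
Proof.
by rewrite ltn_exp2l // addn1 ltnS expnS leq_pmulr // expn_gt0 ltnW ?len_gt1.
Qed.

(** Axis 0 alone contributes at least 1 to each level. *)
Lemma budget_ge : 0 < D -> 0 < N -> R <= budget R.
Proof.
move=> D0 N0; rewrite -[X in X <= _](subn1 R.+1) -[X in X <= _]muln1 -sum_nat_const_nat.
rewrite /budget !big_nat; apply: leq_sum => s /andP[s1 _].
rewrite (bigD1 (Ordinal D0)) //=; apply: leq_trans (leq_addr _ _).
by rewrite leq_min s1 (nn_gt0 D0 N0).
Qed.

Lemma nbits_R : nbits R <= len.
Proof. by rewrite /nbits; case: eqP => // _; apply: mem_bits R_in. Qed.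

Lemma program_ok :
  wp F inp A V len GB program (fun s' => correct_answer T R (ou s')) st0.
Proof.
have q1 : 1 < q := card_finNzRing_gt1 F.
have lenV : len < V by apply: ltn_trans (ltn_expl _ (isT : 1 < 2)) V_gt.
have lenA : len < A by rewrite addn1 ltnS leq_addl.
have qV : q <= V by apply: ltnW; apply: ltn_trans q_lt V_gt.
have RV : R < V by apply: ltn_trans (mem_lt R_in) V_gt.
have GV : q ^ (H * budget RR) < V.
  apply: (@leq_ltn_trans (q ^ (len ^ 3))); first by rewrite leq_pexp2l ?budget_bound // ltnW.
  apply: (@leq_ltn_trans ((2 ^ len) ^ (len ^ 3))).
    have l3 : 0 < len ^ 3 by rewrite expn_gt0 (ltnW len_gt1).
    by rewrite (leq_exp2r _ _ l3); apply: ltnW q_lt.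
  by rewrite -expnM -expnS ltn_exp2l // addn1.
have GGB : q ^ (H * budget RR) <= GB.
  by rewrite leq_pexp2l ?leq_mul2l ?budget_le ?geq_minl ?orbT // ltnW.
have RGB : 0 < D -> 0 < N -> R <= GB.
  move=> D0 N0; apply: leq_trans (ltnW (ltn_expl R q1)) _.
  rewrite leq_pexp2l ?(ltnW q1) //; apply: leq_trans (budget_ge D0 N0) _.
  exact: leq_pmull.
have bA : D * N * RR * H <= A.
  apply: (@leq_trans (len ^ 3)); last by rewrite -addnA leq_addr.
  rewrite -!mulnA !expnS expn0 muln1; apply: leq_mul D_len _.
  apply: leq_mul N_len _; apply: leq_trans NH_len.
  by rewrite leq_mul2r geq_minr orbT.
have iT := inT T R; have inn := inn T R; have nN := nnN cT.
apply: wp_if => /= hD.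
  have D0 : 0 < D by rewrite lt0n.
  apply: (wp_post _ (main_ok (nn := nn n) (t0 := t0 T) H0 _ _ _ _ inn iT nN D_len NH_len
    lenA bA lenV qV RV GV GGB RGB _)) => // s' _.
  exact: main_correct.
apply: (wp_post _ (scalar_ok (nn := nn n) (t0 := t0 T) GB H0 _ _ iT NH_len
    lenA lenV qV RV hD nbits_R _)) => // s' _ ->.
exact: scalar_correct.
Qed.

Lemma program_runs C e : time_bound len GB program <= C * len ^ e * GB ->
  exists out : seq nat, correct_answer T R out /\
  runs_within F (compile program) inp out (C * len ^ e * GB) (360 * len ^ 7).
Proof.
move=> tb; have [sf ans] := program_ok.
have A1 : 1 < A by rewrite addn1 ltnS (leq_trans (ltnW len_gt1)) ?leq_addl.
have V0 : 0 < V by rewrite expn_gt0.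
have [||m [r ok [t [ht et okt]]]] :=
  @compile_correct F inp A V len GB A1 V0 program wf_program st0 [::] [::] sf.
- by move=> k i _; rewrite nth_nil.
- by [].
exists (ou (denote F inp program st0)); split=> //.
exists t; split.
- exact: leq_trans ht tb.
- by rewrite /run /init et.
- by rewrite /run /init et.
move=> u /okt/(bits_mem_ok V0) h; apply: leq_trans h _.
rewrite trunc_expnK //; have l1 := len_gt1; move: (len) l1 => l l1.
(* There are 40 arrays of at most 3 l ^ 3 cells, each of at most l ^ 4 + 2 <= 3 l ^ 4 bits. *)
have -> : 360 * l ^ 7 = 40 * (3 * l ^ 3) * (3 * l ^ 4).
  by rewrite (expnD l 3 4); move: (l ^ 3) (l ^ 4) => a b; lia.
have h3 : l ^ 1 <= l ^ 3 by rewrite leq_pexp2l // ltnW.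
have h4 : 1 <= l ^ 4 by rewrite expn_gt0 ltnW.
have h5 : 1 <= l ^ 3 by rewrite expn_gt0 ltnW.
rewrite expn1 in h3; apply: leq_mul; last by lia.
by rewrite /n_arrays leq_mul2l; apply/orP; right; lia.
Qed.

End Final.

Theorem theorem2 :
  exists (P : cmd) (c : nat),
  forall (F : finFieldType) (H D : nat) (n : 'I_D -> nat)
         (T : tensor (truncpoly F H) n) (R : nat),
    1 <= H ->
    concise T ->
    let inp := encode_input T R in
    let size_inp := bits inp in
    exists out : seq nat,
      correct_answer T R out /\
      runs_within F P inp out
        (c * size_inp ^ c
           * #|F| ^ (H * \sum_(1 <= r < R.+1) \sum_(d < D) minn r (n d)))
        (c * size_inp ^ c).
Proof.
have [C [e tb]] := time_bound_poly program.
(* A single constant serves as factor and exponent in both bounds, so it dominates C and e for the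
   time, 360 and 7 for the space. *)
exists (compile program), (C + e + 360) => F H D n T R H0 cT inp size_inp.
have l1 : 0 < size_inp by apply: ltnW; apply: len_gt1.
have GB0 k : 0 < #|F| ^ k by rewrite expn_gt0 cardF_gt0.
have := tb size_inp (#|F| ^ (H * budget D (nn n) R)) l1 (GB0 _).
rewrite gdepth_program expn1 => {}tb.
have [out [ans [t [ht e1 e2 sp]]]] := program_runs H0 cT tb.
have cl k : k <= C + e + 360 -> size_inp ^ k <= size_inp ^ (C + e + 360).
  by move=> hk; rewrite leq_pexp2l.
exists out; split=> //; exists t; split=> //.
- apply: leq_trans ht _; rewrite (_ : budget D (nn n) R =
    \sum_(1 <= r < R.+1) \sum_(d < D) minn r (n d)); last first.
    by apply: eq_bigr => r _; apply: eq_bigr => d _; rewrite nnE.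
  apply: leq_mul (leqnn _); apply: leq_mul; first by lia.
  by apply: cl; lia.
- move=> u /sp h; apply: leq_trans h _; apply: leq_mul; first by lia.
  by apply: cl; lia.
Qed.
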